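(* Let $n\ge 2$ and let $f \in \mathfrak{T}(2,n,* )$ be such that $P(f)$ has positive area. Then $$ |S(f,\mathfrak{T}(2,n,* ))| = O\left(\min\left(n,\ \mathcal{P}(P(f)) + \frac{1}{q_{min}(P(f))}\right)\right), $$ where the implied constant is absolute (independent of $n$ and $f$).
   Context: Let $E_n^2=\{0,1,\dots,n-1\}^2$. For $f:E_n^2\to\{0,1\}$ let $M_\nu(f)=\{x\in E_n^2: f(x)=\nu\}$. A function $f:E_n^2\to\{0,1\}$ is $k$-threshold if there are real numbers $a_{ij}$ with $M_1(f)=\{x\in E_n^2: a_{i1}x_1+a_{i2}x_2\le a_{i0},\ i=1,\dots,k\}$; $\mathfrak{T}(2,n,* )$ is the class of all functions over $E_n^2$ that are $k$-threshold for some natural $k$. For $f\in\mathcal{C}$, a point $x$ is essential for $f$ with respect to $\mathcal{C}$ if some $g\in\mathcal{C}$ differs from $f$ exactly at $x$; $S(f,\mathcal{C})$ denotes the set of such points. $P(f)=\textup{Conv}(M_1(f))$. For a convex polygon $P$, $\mathcal{P}(P)$ is its perimeter and $q_{min}(P)$ is the minimum interior angle between neighboring edges of $P$. *)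

(* Defs.v *)
From HB Require Import structures.
From mathcomp Require Import all_boot all_order all_algebra.
From mathcomp Require Import all_classical all_reals all_analysis.

Set Implicit Arguments.
Unset Strict Implicit.
Unset Printing Implicit Defensive.

Import Order.TTheory GRing.Theory Num.Theory.

Local Open Scope classical_set_scope.
Local Open Scope ring_scope.
Local Open Scope convex_scope.

(** * Threshold functions on the grid *)

Definition grid (n : nat) := ('I_n * 'I_n)%type.

Definition k_threshold (R : realType) (k n : nat) (f : {ffun grid n -> bool}) :=
  exists a0 a1 a2 : 'I_k -> R, forall x : grid n,
    f x <-> forall i, a1 i * (x.1)%:R + a2 i * (x.2)%:R <= a0 i.

Definition threshold_class (R : realType) (n : nat) :
    set {ffun grid n -> bool} :=
  [set f | exists k, k_threshold R k f].
Arguments threshold_class : clear implicits.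

Definition essential (n : nat) (C : set {ffun grid n -> bool})
    (f : {ffun grid n -> bool}) (x : grid n) :=
  exists2 g, C g & forall y, g y != f y <-> y = x.

Definition essential_points (n : nat) (f : {ffun grid n -> bool})
    (C : set {ffun grid n -> bool}) : {set grid n} :=
  finset (fun x => `[< essential C f x >]).

(** * Convex polygons in the plane *)

Definition plane (R : realType) := (R^o * R^o)%type.

Definition conv_hull (R : realType) (A : set (plane R)) : set (plane R) :=
  smallest (@convex_set R (plane R)) A.

Definition area (R : realType) (P : set (plane R)) : \bar R :=
  (@lebesgue_measure R \x @lebesgue_measure R)%E P.

Definition dot (R : realType) (u v : plane R) : R := u.1 * v.1 + u.2 * v.2.

(** Euclidean; the library norm on a product is the sup norm. *)
Definition norm2 (R : realType) (u : plane R) : R := Num.sqrt (dot u u).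

Definition cross (R : realType) (u v : plane R) : R := u.1 * v.2 - u.2 * v.1.

(** Vertices are the extreme points. *)
Definition vertex (R : realType) (P : set (plane R)) (v : plane R) :=
  P v /\ forall (x y : convex_lmodType (plane R)) (t : {i01 R}), P x -> P y ->
    0 < t%:num < 1 -> x <| t |> y = v -> x = v /\ y = v.

(** Edges are oriented counterclockwise: [P] lies to the left of the line from
    [e.1] to [e.2]. For a polygon of positive area, this lists each edge once. *)
Definition edge (R : realType) (P : set (plane R)) : set (plane R * plane R) :=
  [set e | [/\ vertex P e.1, vertex P e.2, e.1 != e.2 &
    forall p, P p -> 0 <= cross (e.2 - e.1) (p - e.1)]].

Definition perimeter (R : realType) (P : set (plane R)) : R :=
  \sum_(e \in edge P) norm2 (e.2 - e.1).

(** The angle u-v-w, in [0, pi]; the interior angles of a convex polygon do not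
    exceed pi. *)
Definition angle (R : realType) (u v w : plane R) : R :=
  acos (dot (u - v) (w - v) / (norm2 (u - v) * norm2 (w - v))).

(** The infimum of a set that is finite and nonempty for a polygon of positive
    area, hence a minimum. *)
Definition qmin (R : realType) (P : set (plane R)) : R :=
  inf [set q | exists u v w, [/\ edge P (u, v), edge P (v, w) & q = angle u v w]].

Definition grid_point (R : realType) (n : nat) (x : grid n) : plane R :=
  ((x.1)%:R, (x.2)%:R).

Definition M1 (R : realType) (n : nat) (f : {ffun grid n -> bool}) :
    set (plane R) :=
  [set grid_point R x | x in [set x | f x]].
Arguments M1 R {n} f.

Definition Pf (R : realType) (n : nat) (f : {ffun grid n -> bool}) :
    set (plane R) :=
  conv_hull (M1 R f).
Arguments Pf R {n} f.

(* Main.v *)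
Require Import Defs.
From HB Require Import structures.
From mathcomp Require Import all_boot all_order all_algebra.
From mathcomp Require Import ring lra zify.
From mathcomp Require Import all_classical all_reals all_analysis.
From mathcomp Require Import measurable_realfun.
Set Implicit Arguments.
Unset Strict Implicit.
Unset Printing Implicit Defensive.
Import Order.TTheory GRing.Theory Num.Theory.
Import numFieldNormedType.Exports.
Local Open Scope ring_scope.

(** The essential points inside [P(f)] are vertices, and there are at most as
    many vertices as edges. An essential point [x] outside [P(f)] lies strictly
    to the right of some edge; since the triangle spanned by [x] and that edge
    contains no new lattice point, [x] lies on the lattice line next to the edge.
    At most two such points also lie outside a neighbouring edge, being then
    determined by two lines. The others fill a segment of that lattice line cut
    off by the two neighbouring edges, so an edge with [k] primitive segments
    sees at most [k + 1] of them plus the positive parts of the cotangents of its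
    two angles. Now [sum k] is at most the perimeter, and also at most [4 n]
    because the edges going in a given axis direction have disjoint projections.
    Positive cotangents occur only at acute angles, hence at no more than four
    vertices, and there they are at most [1 / q_min]; alternatively the points on
    one line number at most [n]. *)

(** * Hull edges of a finite planar set *)

(** Totality and transitivity are asked only on [s], because comparing directions by angle is
    transitive only within an open half plane. *)
Lemma ex_least (T : eqType) (r : rel T) (s : seq T) :
    s != [::] -> {in s &, total r} -> {in s & &, transitive r} ->
  exists2 m, m \in s & {in s, forall p, r m p}.
Proof.
elim: s => [//|x s IH] _ tot tr.
have rxx : r x x by have := tot x x (mem_head _ _) (mem_head _ _); rewrite orbb.
have sub y : y \in s -> y \in x :: s by rewrite inE orbC => ->.
have [->|s0] := eqVneq s [::].
  by exists x; rewrite ?mem_head// => p; rewrite inE => /eqP->.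
have [||m ms mP] := IH s0.
- by move=> p q ps qs; apply: tot; exact: sub.
- by move=> p q t ps qs ts; apply: tr; exact: sub.
have := tot x m (mem_head _ _) (sub _ ms) => /orP[xm|mx].
- exists x; rewrite ?mem_head// => p; rewrite inE => /orP[/eqP->//|ps].
  by apply: (tr m) (mP _ ps) => //; rewrite ?mem_head ?sub.
- by exists m; rewrite ?sub// => p; rewrite inE => /orP[/eqP->//|/mP].
Qed.

Section PlanarPoints.
Variables (R : realType) (T : finType) (X Y : T -> R).

(** Twice the signed area of the triangle [a], [b], [p], positive when [p] lies to the left of the
    line from [a] to [b]. *)
Definition orient a b p := (X b - X a) * (Y p - Y a) - (Y b - Y a) * (X p - X a).
Definition dotat a b p := (X b - X a) * (X p - X a) + (Y b - Y a) * (Y p - Y a).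
Definition linat (l1 l2 : R) v p := l1 * (X p - X v) + l2 * (Y p - Y v).

Lemma orientC v p q : orient v p q = - orient v q p.
Proof. by rewrite /orient; ring. Qed.

Lemma orient_rot a b c : orient a b c = orient b c a.
Proof. by rewrite /orient; ring. Qed.

Lemma orient_id a b : orient a b a = 0.
Proof. by rewrite /orient; ring. Qed.

(** The linear dependence of three plane vectors, evaluated under a linear form. Where the form is
    positive, it makes the angular order transitive. *)
Lemma linat_orient l1 l2 v s t u :
  linat l1 l2 v t * orient v s u = linat l1 l2 v s * orient v t u + linat l1 l2 v u * orient v s t.
Proof. by rewrite /orient /linat; ring. Qed.

(* A linear form positive on [S - v] makes the directions from [v] an ordered
   pencil; [sg] selects the sense of rotation, [ep] whether ties go to the
   farthest ([ep = 1]) or the nearest ([ep = -1]) point. *)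
Lemma ex_angular_extremum (sg ep l1 l2 : R) (v : T) (S : {set T}) :
    sg != 0 -> S != finset.set0 -> (forall p, p \in S -> 0 < linat l1 l2 v p) ->
  exists2 w, w \in S & forall p, p \in S ->
    0 < sg * orient v w p \/ orient v w p = 0 /\ ep * linat l1 l2 v p <= ep * linat l1 l2 v w.
Proof.
move=> sg0 S0 lpos; set l := linat l1 l2 v in lpos *.
pose r p q := (0 < sg * orient v p q) || ((orient v p q == 0) && (ep * l q <= ep * l p)).
have [|||w] := @ex_least T r (enum S).
- apply: contra S0 => /eqP S0; apply/eqP/setP => x.
  by rewrite inE -mem_enum S0.
- move=> p q _ _; rewrite /r (orientC v q p) mulrN oppr_gt0 oppr_eq0.
  have [c0|c0] := eqVneq (orient v p q) 0; first by rewrite c0 mulr0 ltxx; exact: le_total.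
  by rewrite !orbF orbC -neq_lt mulf_neq0.
- move=> t s u; rewrite !mem_enum => /lpos lt0 /lpos ls0 /lpos lu0.
  have E := linat_orient l1 l2 v s t u; rewrite -/l in E.
  have E' : sg * orient v s u = (l s * (sg * orient v t u) + l u * (sg * orient v s t)) / l t.
    apply: (@mulIf _ (l t)); first by rewrite gt_eqF.
    by rewrite divfK ?gt_eqF// -mulrA (mulrC _ (l t)) E; ring.
  move=> /orP[st|/andP[/eqP st lst]] /orP[tu|/andP[/eqP tu ltu]]; rewrite /r; apply/orP.
  + by left; rewrite E'; apply: divr_gt0 => //; apply: addr_gt0; apply: mulr_gt0.
  + by left; rewrite E' tu !mulr0 add0r; apply: divr_gt0 => //; apply: mulr_gt0.
  + by left; rewrite E' st !mulr0 addr0; apply: divr_gt0 => //; apply: mulr_gt0.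
  + right; rewrite (le_trans ltu lst) andbT.
    by move/eqP: E; rewrite st tu !mulr0 addr0 mulf_eq0 gt_eqF.
- rewrite mem_enum => wS wP; exists w => // p pS.
  by have := wP p; rewrite mem_enum => /(_ pS) /orP[|/andP[/eqP]]; [left|right].
Qed.

Hypothesis XY_inj : forall p q, X p = X q -> Y p = Y q -> p = q.

Lemma dotat_self_gt0 a b : a != b -> 0 < dotat a b b.
Proof.
move=> ab; rewrite lt_neqAle /dotat -!expr2 addr_ge0 ?sqr_ge0// andbT eq_sym.
apply: contra ab; rewrite paddr_eq0 ?sqr_ge0// !sqrf_eq0 !subr_eq0.
by move=> /andP[/eqP hx /eqP hy]; apply/eqP/XY_inj.
Qed.

Lemma dotat_self_le0 a b : dotat a b b <= 0 -> a = b.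
Proof. by move=> h; apply/eqP; apply: contraLR h => /dotat_self_gt0; rewrite -ltNge. Qed.

Variable A : {set T}.
Hypothesis noncollinear : forall l1 l2 l0,
  (forall p, p \in A -> l1 * X p + l2 * Y p = l0) -> l1 = 0 /\ l2 = 0.

(** An exposed point. The strictly supporting form also puts the other points into a half plane,
    where directions can be sorted by angle. *)
Definition vert v := v \in A /\
  exists l1 l2, forall p, p \in A -> p != v -> 0 < linat l1 l2 v p.

(* For [sg = 1] the edges of the hull of [A], oriented counterclockwise. *)
Definition sedge (sg : R) a b := [/\ a \in A, b \in A, a != b &
  forall p, p \in A -> 0 <= sg * orient a b p /\ (orient a b p = 0 -> dotat p a b <= 0)].

Definition hedge := sedge 1.

(** Reversal flips [sg], so facts on outgoing edges proved for both signs carry over to incoming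
    ones. *)
Lemma sedgeN a b : sedge (-1) a b -> hedge b a.
Proof.
move=> [aA bA ab h]; split => //; first by rewrite eq_sym.
move=> p /h[]; have -> : orient b a p = - orient a b p by rewrite /orient; ring.
have -> : dotat p b a = dotat p a b by rewrite /dotat; ring.
by move=> h1 h2; split; [lra | move=> h3; apply: h2; lra].
Qed.

Lemma hedgeN a b : hedge b a -> sedge (-1) a b.
Proof.
move=> [aA bA ab h]; split => //; first by rewrite eq_sym.
move=> p /h[]; have -> : orient b a p = - orient a b p by rewrite /orient; ring.
have -> : dotat p b a = dotat p a b by rewrite /dotat; ring.
by move=> h1 h2; split; [lra | move=> h3; apply: h2; lra].
Qed.

Lemma off_line a b : a != b -> ~ (forall p, p \in A -> orient a b p = 0).
Proof.
move=> ab h.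
have [] := @noncollinear (- (Y b - Y a)) (X b - X a)
   ((X b - X a) * Y a - (Y b - Y a) * X a).
  by move=> p /h; rewrite /orient => e; lra.
move=> h1 h2; move: ab; apply/negP/negPn/eqP/XY_inj; lra.
Qed.

Lemma ex_other v : A :\ v != finset.set0.
Proof.
apply/negP => /eqP e; have [] := @noncollinear 1 0 (X v).
  move=> p pA; have [->|pv] := eqVneq p v; first by ring.
  by have := finset.in_set0 p; rewrite -e !inE pv pA.
by move/eqP; rewrite oner_eq0.
Qed.

(** The edge ends at the point extreme in angle as seen from [v], the farthest one in case of
    ties. *)
Lemma vert_sedge sg v : sg != 0 -> vert v -> exists w, sedge sg v w.
Proof.
move=> sg0 [vA [l1 [l2 lpos]]].
have [|w] := @ex_angular_extremum sg 1 l1 l2 v (A :\ v) sg0 (ex_other v).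
  by move=> p; rewrite !inE => /andP[pv pA]; exact: lpos.
rewrite !inE => /andP[wv wA] wP; exists w; split => //; first by rewrite eq_sym.
move=> p pA; have [->|pv] := eqVneq p v.
  rewrite orient_id mulr0; split=> // _; rewrite /dotat; lra.
have := wP p; rewrite !inE pv pA => /(_ isT)[h|[h1 h2]].
  by split; [exact: ltW | move=> h'; move: h; rewrite h' mulr0 ltxx].
rewrite h1 mulr0; split=> // _.
have lw := lpos w wA wv; have lp := lpos p pA pv.
(* Here [p - v] is [r] times [w - v], with [r] the quotient of the two values of the form, so
   [dotat p v w] is [- r (1 - r)] times the squared length of [w - v]. *)
have e : linat l1 l2 v w * linat l1 l2 v w * dotat p v w
       = - (linat l1 l2 v p * (linat l1 l2 v w - linat l1 l2 v p) * dotat v w w).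
  move: h1; rewrite /orient /linat /dotat => h1.
  set a := X w - X v; set b := Y w - Y v.
  have -> : X w - X p = a - (X p - X v) by rewrite /a; ring.
  have -> : Y w - Y p = b - (Y p - Y v) by rewrite /b; ring.
  have -> : X v - X p = - (X p - X v) by ring.
  have -> : Y v - Y p = - (Y p - Y v) by ring.
  rewrite -/a -/b in h1; move: h1.
  move: (X p - X v) (Y p - Y v) => c d h1.
  have {h1} h1 : a * d = b * c by lra.
  have h : a * (l1 * c + l2 * d) = c * (l1 * a + l2 * b).
    by transitivity (l1 * a * c + l2 * (a * d)); [ring | rewrite h1; ring].
  have h' : b * (l1 * c + l2 * d) = d * (l1 * a + l2 * b).
    by transitivity (l1 * (b * c) + l2 * b * d); [ring | rewrite -h1; ring].
  set L := l1 * a + l2 * b in h h' *; set M := l1 * c + l2 * d in h h' *.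
  transitivity (- (L * c) * (L * a - L * c) - (L * d) * (L * b - L * d)); first by ring.
  rewrite ![L * c]mulrC ![L * d]mulrC -h -h'; ring.
rewrite -(@pmulr_rle0 _ (linat l1 l2 v w * linat l1 l2 v w)) ?mulr_gt0// e oppr_le0.
rewrite !mul1r in h2.
by rewrite mulr_ge0 ?(ltW (dotat_self_gt0 _)) 1?eq_sym// mulr_ge0 ?(ltW lp)// subr_ge0.
Qed.

(** Lets a weakly supporting form, with a second form breaking its ties, be replaced by a single
    strictly supporting one. *)
Lemma ex_dominating (S : {set T}) (al be : T -> R) :
  exists2 M, 0 < M & forall p, p \in S -> 0 < al p -> 0 < M * al p + be p.
Proof.
exists (1 + \sum_p `|be p / al p|).
  by rewrite ltr_wpDr ?sumr_ge0.
move=> p pS ap.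
have h : `|be p / al p| <= \sum_q `|be q / al q|.
  by rewrite (bigD1 p)//= lerDl sumr_ge0.
have h' : - be p <= al p * `|be p / al p|.
  rewrite normrM normfV (gtr0_norm ap) mulrCA divff ?gt_eqF// mulr1.
  by rewrite lerNl; have := ler_norm (- be p); rewrite normrN; lra.
have := ler_wpM2l (ltW ap) h; lra.
Qed.

(** The form vanishing on the edge line is tilted slightly: the points of [A] on that line lie
    between [a] and [b], so [dotat a b] is positive there except at [a]. *)
Lemma sedge_vert sg a b : sg != 0 -> sedge sg a b -> vert a.
Proof.
move=> sg0 [aA bA ab h]; split => //.
have [M M0 Mp] := ex_dominating A (fun p => sg * orient a b p) (dotat a b).
exists (- M * sg * (Y b - Y a) + (X b - X a)), (M * sg * (X b - X a) + (Y b - Y a)).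
move=> p pA pa.
have -> : linat (- M * sg * (Y b - Y a) + (X b - X a))
    (M * sg * (X b - X a) + (Y b - Y a)) a p = M * (sg * orient a b p) + dotat a b p.
  by rewrite /linat /orient /dotat; ring.
have [] := h p pA; rewrite le_eqVlt => /orP[/eqP/esym e|c0 _]; last exact: Mp.
have /eqP c0 : orient a b p == 0 by move/eqP: e; rewrite mulf_eq0 (negPf sg0).
move/(_ c0); rewrite e mulr0 add0r; have := dotat_self_gt0 pa.
have -> : dotat p a b = dotat p a a - dotat a b p by rewrite /dotat; ring.
lra.
Qed.

Lemma vert_next v : vert v -> exists w, hedge v w.
Proof. exact/vert_sedge/oner_neq0. Qed.

Lemma vert_prev v : vert v -> exists w, hedge w v.
Proof.
have N1 : -1 != 0 :> R by rewrite oppr_eq0 oner_eq0.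
by move=> /(vert_sedge N1)[w /sedgeN]; exists w.
Qed.

Lemma hedge_vert a b : hedge a b -> vert a /\ vert b.
Proof.
have N1 : -1 != 0 :> R by rewrite oppr_eq0 oner_eq0.
by move=> h; split; [exact: sedge_vert (oner_neq0 _) h | exact: sedge_vert N1 (hedgeN h)].
Qed.

(** Each endpoint lies on the closed [sg] side of the other edge, so all three points are collinear;
    then [b] and [b'] each lie between [a] and the other. *)
Lemma sedge_inj sg a b b' : sg != 0 -> sedge sg a b -> sedge sg a b' -> b = b'.
Proof.
move=> sg0 [aA bA ab h] [_ b'A ab' h'].
have [c1 d1] := h _ b'A; have [] := h' _ bA; rewrite orientC mulrN => c2 d2.
have /eqP : sg * orient a b b' = 0 by lra.
rewrite mulf_eq0 (negPf sg0)/= => /eqP c0.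
have e : dotat b b' b' = dotat b' a b + dotat b a b' by rewrite /dotat; ring.
apply: dotat_self_le0; rewrite e.
have := d1 c0; have := d2; rewrite c0 oppr0 => /(_ erefl); lra.
Qed.

Lemma hedge_next_inj a b b' : hedge a b -> hedge a b' -> b = b'.
Proof. exact/sedge_inj/oner_neq0. Qed.

Lemma hedge_prev_inj a a' b : hedge a b -> hedge a' b -> a = a'.
Proof.
have N1 : -1 != 0 :> R by rewrite oppr_eq0 oner_eq0.
by move=> /hedgeN h /hedgeN h'; exact: (sedge_inj N1 h h').
Qed.

Lemma hedge_ge0 a b p : hedge a b -> p \in A -> 0 <= orient a b p.
Proof. by case=> _ _ _ h /h[]; rewrite mul1r. Qed.

(** If the three points were collinear, the betweenness clauses of the two edges would give [a = c],
    and [A] would lie on both sides of one line. *)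
Lemma hedge_turn a b c : hedge a b -> hedge b c -> 0 < orient a b c.
Proof.
move=> hab hbc; have [aA bA ab h] := hab; have [_ cA bc h'] := hbc.
rewrite lt_neqAle (hedge_ge0 hab cA) andbT eq_sym; apply/negP => /eqP c0.
have d1 := (h _ cA).2 c0.
have d2 := (h' _ aA).2; rewrite -orient_rot in d2; have {}d2 := d2 c0.
have e : dotat a c c = dotat c a b + dotat a b c by rewrite /dotat; ring.
have ac : a = c by apply: dotat_self_le0; rewrite e; lra.
subst c; apply: (off_line ab) => p pA; apply/eqP; rewrite eq_le.
rewrite (hedge_ge0 hab pA) andbT.
have := hedge_ge0 hbc pA.
by have -> : orient b a p = - orient a b p by [rewrite /orient; ring]; rewrite oppr_ge0.
Qed.

(* The tangent point [a] nearest to [x], followed by its outgoing edge. *)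
Lemma ex_visible_edge l1 l2 x : (forall p, p \in A -> 0 < linat l1 l2 x p) ->
  exists a b, hedge a b /\ orient a b x < 0.
Proof.
move=> lpos.
have N1 : -1 != 0 :> R by rewrite oppr_eq0 oner_eq0.
have A0 : A != finset.set0.
  by apply: contra (ex_other x) => /eqP ->; rewrite finset.set0D.
have [a aA aP] := ex_angular_extremum (-1) N1 A0 lpos.
have xa : x != a.
  by apply/eqP => xa; have := lpos a aA; rewrite xa /linat !subrr !mulr0 addr0 ltxx.
pose ft p := (X a - X x) * (X p - X a) + (Y a - Y x) * (Y p - Y a).
have farther p : p \in A -> p != a -> orient x a p = 0 -> 0 < ft p.
  move=> pA pa c0; have [|[_ lap]] := aP p pA; first by rewrite c0 mulr0 ltxx.
  have la := lpos a aA.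
  have e : linat l1 l2 x a * ft p = (linat l1 l2 x p - linat l1 l2 x a) * dotat x a a.
    have : orient x a p * (l2 * (X a - X x) - l1 * (Y a - Y x)) = 0 by rewrite c0 mul0r.
    by rewrite /linat /orient /ft /dotat => e; apply/eqP; rewrite -subr_eq0 -oppr_eq0 -e; apply/eqP; ring.
  have f0 : 0 <= ft p.
    rewrite -(@pmulr_rge0 _ (linat l1 l2 x a))// e mulr_ge0 ?(ltW (dotat_self_gt0 xa))//.
    by rewrite subr_ge0; lra.
  rewrite lt_neqAle f0 andbT eq_sym; apply/eqP => f00.
  have : dotat x a a * dotat a p p = ft p ^+ 2 + orient x a p ^+ 2.
    by rewrite /dotat /ft /orient; ring.
  rewrite f00 c0 expr0n addr0 => /eqP; rewrite mulf_eq0 !gt_eqF ?dotat_self_gt0//.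
  by rewrite eq_sym.
have va : vert a.
  split => //.
  have [M M0 Mp] := ex_dominating A (fun p => - orient x a p) ft.
  exists (M * (Y a - Y x) + (X a - X x)), (- M * (X a - X x) + (Y a - Y x)) => p pA pa.
  have -> : linat (M * (Y a - Y x) + (X a - X x)) (- M * (X a - X x) + (Y a - Y x)) a p
     = M * (- orient x a p) + ft p by rewrite /linat /orient /ft; ring.
  have [c0|[c0 _]] := aP p pA; first by apply: Mp => //; lra.
  by rewrite c0 oppr0 mulr0 add0r farther.
have [b hab] := vert_next va; exists a, b; split=> //.
have [_ bA ab _] := hab.
have e : orient a b x = orient x a b by rewrite /orient; ring.
have cle p : p \in A -> orient x a p <= 0 by move=> /aP[|[->]//]; lra.
rewrite lt_neqAle e cle// andbT; apply/eqP => c0.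
have fb : 0 < ft b by apply: farther => //; rewrite eq_sym.
(* With [b] on the line from [x] through [a], the set [A] is to the right of that line and, because
   of the edge, also to its left. *)
apply: (off_line xa) => p pA; apply/eqP; rewrite eq_le cle//=.
have E : dotat x a a * orient a b p = ft b * orient x a p.
  have : orient x a b * ((X a - X x) * (X p - X a) + (Y a - Y x) * (Y p - Y a)) = 0.
    by rewrite c0 mul0r.
  rewrite /orient /ft /dotat => e'; apply/eqP; rewrite -subr_eq0 -oppr_eq0 -e'.
  by apply/eqP; ring.
by rewrite -(pmulr_rge0 _ fb) -E mulr_ge0 ?(hedge_ge0 hab)// ltW ?dotat_self_gt0.
Qed.

Definition acute v := v \in A /\ forall p q, p \in A -> q \in A ->
  p != v -> q != v -> 0 < dotat v p q.

(** All of [A] lies in the cone at [b] spanned by the two edges, and nonzero vectors of an acute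
    cone have positive inner products. *)
Lemma hedge_acute a b c : hedge a b -> hedge b c -> 0 < dotat b a c -> acute b.
Proof.
move=> hab hbc d0; have D0 := hedge_turn hab hbc.
have [_ bA _ _] := hab; split => // p q pA qA pb qb.
(* Both vectors are expanded in the basis [a - b], [c - b] by Cramer's rule. *)
have dc (r s : T) : (orient a b c) ^+ 2 * dotat b r s =
   orient a b r * orient a b s * dotat b c c + (orient a b r * orient b c s + orient b c r * orient a b s) * dotat b a c
   + orient b c r * orient b c s * dotat b a a.
  by rewrite /orient /dotat; ring.
have [ab bc] : a != b /\ c != b.
  by have [_ _ ? _] := hab; have [_ _ ? _] := hbc; rewrite (eq_sym c).
have ua : 0 < dotat b a a by rewrite dotat_self_gt0// eq_sym.
have uc : 0 < dotat b c c by rewrite dotat_self_gt0// eq_sym.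
have pos r : r \in A -> r != b -> 0 < orient a b r \/ 0 < orient b c r.
  move=> rA rb; have := hedge_ge0 hab rA; rewrite le_eqVlt => /orP[/eqP/esym e1|]; last by left.
  have := hedge_ge0 hbc rA; rewrite le_eqVlt => /orP[/eqP/esym e2|]; last by right.
  have /eqP : orient a b c ^+ 2 * dotat b r r = 0 by rewrite dc e1 e2; ring.
  by rewrite mulf_eq0 expf_eq0/= gt_eqF//= gt_eqF// dotat_self_gt0// eq_sym.
rewrite -(@pmulr_rgt0 _ (orient a b c ^+ 2)) ?exprn_gt0// dc.
have p1 := hedge_ge0 hab pA; have p2 := hedge_ge0 hbc pA.
have q1 := hedge_ge0 hab qA; have q2 := hedge_ge0 hbc qA.
have m1 : 0 <= orient a b p * orient a b q * dotat b c c by rewrite !mulr_ge0// ltW.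
have m2 : 0 <= orient a b p * orient b c q * dotat b a c by rewrite !mulr_ge0// ltW.
have m3 : 0 <= orient b c p * orient a b q * dotat b a c by rewrite !mulr_ge0// ltW.
have m4 : 0 <= orient b c p * orient b c q * dotat b a a by rewrite !mulr_ge0// ltW.
have [{}p1|{}p2] := pos p pA pb; have [{}q1|{}q2] := pos q qA qb.
- have : 0 < orient a b p * orient a b q * dotat b c c by rewrite !mulr_gt0.
  by move: m1 m2 m3 m4; clear; lra.
- have : 0 < orient a b p * orient b c q * dotat b a c by rewrite !mulr_gt0.
  by move: m1 m2 m3 m4; clear; lra.
- have : 0 < orient b c p * orient a b q * dotat b a c by rewrite !mulr_gt0.
  by move: m1 m2 m3 m4; clear; lra.
- have : 0 < orient b c p * orient b c q * dotat b a a by rewrite !mulr_gt0.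
  by move: m1 m2 m3 m4; clear; lra.
Qed.

Lemma ex_lowest (F : T -> R) : exists2 m, m \in A & forall p, p \in A -> F m <= F p.
Proof.
have [|||m] := @ex_least T (fun p q => F p <= F q) (enum A).
- have : A != finset.set0.
    case: (pickP (mem A)) => [x xA|A0]; first by apply/set0Pn; exists x.
    have [] := @noncollinear 1 0 0; last by move/eqP; rewrite oner_eq0.
    by move=> p pA; have := A0 p; rewrite /= pA.
  by apply: contra => /eqP S0; apply/eqP/setP => x; rewrite inE -mem_enum S0.
- by move=> p q _ _; exact: le_total.
- by move=> p q r _ _ _; exact: le_trans.
- by rewrite mem_enum => mA mP; exists m => // p pA; apply: mP; rewrite mem_enum.
Qed.

(* An acute point is the leftmost, rightmost, lowest or highest one. *)
Lemma acute_four : exists F : {set T}, (#|F| <= 4)%N /\ forall v, acute v -> v \in F.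
Proof.
have [l lA lP] := ex_lowest X.
have [r rA rP] := ex_lowest (fun p => - X p).
have [b bA bP] := ex_lowest Y.
have [t tA tP] := ex_lowest (fun p => - Y p).
exists (finset.setU (finset.setU [set l] [set r]) (finset.setU [set b] [set t]))%SET; split.
  rewrite (leq_trans (leq_card_setU _ _))// (@leq_add _ _ 2 2)//.
    by rewrite (leq_trans (leq_card_setU _ _))// !cards1.
  by rewrite (leq_trans (leq_card_setU _ _))// !cards1.
move=> v [vA vP]; rewrite !inE; apply/negP => /negP.
rewrite !negb_or => /andP[/andP[lv rv] /andP[bv tv]].
rewrite eq_sym in lv; rewrite eq_sym in rv; rewrite eq_sym in bv; rewrite eq_sym in tv.
have hlr := vP l r lA rA lv rv; have hbt := vP b t bA tA bv tv.
have hlb := vP l b lA bA lv bv; have hrb := vP r b rA bA rv bv.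
have hlt := vP l t lA tA lv tv; have hrt := vP r t rA tA rv tv.
move: (lP v vA) (rP v vA) (bP v vA) (tP v vA) hlr hbt hlb hrb hlt hrt.
rewrite /dotat !lerN2 -![X l <= _]subr_le0 -![X v <= _]subr_ge0.
rewrite -![Y b <= _]subr_le0 -![Y v <= _]subr_ge0.
move: (X l - X v) (X r - X v) (X b - X v) (X t - X v) => xl xr xb xt.
move: (Y l - Y v) (Y r - Y v) (Y b - Y v) (Y t - Y v) => yl yr yb yt.
clear=> xl0 xr0 yb0 yt0 hlr hbt hlb hrb hlt hrt.
(* [l] and [r] must be on the same side of the horizontal line through [v]; the extreme point of the
   other side, [b] or [t], then makes no acute angle with one of them. *)
have [yl0|yl0] := leP 0 yl; have [yr0|yr0] := leP 0 yr.
- by have [xb0|xb0] := leP 0 xb; nra.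
- nra.
- nra.
- by have [xt0|xt0] := leP 0 xt; nra.
Qed.

(* Both edges contain a point of the level line [d = c]; each of these points
   lies to the left of the other edge, hence they coincide. *)
Lemma hedge_shadow_inj d1 d2 c a b a' b' : hedge a b -> hedge a' b' ->
    d1 * X a + d2 * Y a <= c -> c < d1 * X b + d2 * Y b ->
    d1 * X a' + d2 * Y a' <= c -> c < d1 * X b' + d2 * Y b' ->
  (a, b) = (a', b').
Proof.
move=> hab hab' ca cb ca' cb'.
have [aA bA _ h] := hab; have [a'A b'A _ h'] := hab'.
have k1 := hedge_ge0 hab a'A; have k2 := hedge_ge0 hab b'A.
have k3 := hedge_ge0 hab' aA; have k4 := hedge_ge0 hab' bA.
pose L := d1 * (X b - X a) + d2 * (Y b - Y a).
pose L' := d1 * (X b' - X a') + d2 * (Y b' - Y a').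
have L0 : 0 < L by rewrite /L; lra.
have L0' : 0 < L' by rewrite /L'; lra.
pose s := c - (d1 * X a + d2 * Y a); pose t := L - s.
pose s' := c - (d1 * X a' + d2 * Y a'); pose t' := L' - s'.
have s0 : 0 <= s by rewrite /s; lra.
have s0' : 0 <= s' by rewrite /s'; lra.
have t0 : 0 < t by rewrite /t /L /s; lra.
have t0' : 0 < t' by rewrite /t' /L' /s'; lra.
(* Weighted left-of relations sum to zero, so every term vanishes. *)
have e : (t' * orient a b a' + s' * orient a b b') + (t * orient a' b' a + s * orient a' b' b) = 0.
  by rewrite /t /t' /s /s' /L /L' /orient; ring.
have n1 : 0 <= t' * orient a b a' by rewrite mulr_ge0// ltW.
have n2 : 0 <= s' * orient a b b' by rewrite mulr_ge0.
have n3 : 0 <= t * orient a' b' a by rewrite mulr_ge0// ltW.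
have n4 : 0 <= s * orient a' b' b by rewrite mulr_ge0.
have /eqP : t' * orient a b a' = 0 by lra.
rewrite mulf_eq0 (gt_eqF t0')/= => /eqP c1.
have /eqP : t * orient a' b' a = 0 by lra.
rewrite mulf_eq0 (gt_eqF t0)/= => /eqP c2.
(* Were [a] and [a'] distinct, each would be strictly ahead of the other for the form with
   coefficients [d1], [d2]. *)
have before x y z : x \in A -> y \in A -> x != y -> x != z ->
    0 < d1 * (X y - X x) + d2 * (Y y - Y x) -> orient x y z = 0 -> dotat z x y <= 0 ->
    0 < d1 * (X z - X x) + d2 * (Y z - Y x).
  move=> xA yA xy xz dxy cz dz.
  have E : (d1 * (X z - X x) + d2 * (Y z - Y x)) * dotat x y y =
           (dotat x z z - dotat z x y) * (d1 * (X y - X x) + d2 * (Y y - Y x)).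
    have : orient x y z * (d2 * (X y - X x) - d1 * (Y y - Y x)) = 0 by rewrite cz mul0r.
    rewrite /orient /dotat => E; apply/eqP; rewrite -subr_eq0 -E; apply/eqP; ring.
  rewrite -(pmulr_lgt0 _ (dotat_self_gt0 xy)) E mulr_gt0//.
  have := dotat_self_gt0 xz; lra.
have [_ _ ab _] := hab; have [_ _ ab' _] := hab'.
have aa' : a = a'.
  apply/eqP/negPn/negP => aa'; have a'a := aa'; rewrite eq_sym in a'a.
  have := before _ _ _ aA bA ab aa' L0 c1 ((h _ a'A).2 c1).
  have := before _ _ _ a'A b'A ab' a'a L0' c2 ((h' _ aA).2 c2).
  lra.
by subst a'; rewrite (hedge_next_inj hab hab').
Qed.

End PlanarPoints.

(** * Lattice points beyond an edge *)

Lemma card_int_spread (T : finType) (S : {set T}) (s : T -> int) :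
    {in S &, injective s} -> S != finset.set0 ->
  exists x y, [/\ x \in S, y \in S & #|S|%:Z <= s x - s y + 1].
Proof.
move=> s_inj S0.
have eS : enum S != [::].
  by apply: contra S0 => /eqP S0; apply/eqP/setP => x; rewrite inE -mem_enum S0.
have [||y] := @ex_least T (fun p q => s p <= s q) (enum S) eS.
- by move=> p q _ _; exact: le_total.
- by move=> p q r _ _ _; exact: le_trans.
rewrite mem_enum => yS yP.
have [||x] := @ex_least T (fun p q => s q <= s p) (enum S) eS.
- by move=> p q _ _; exact: le_total.
- by move=> p q r _ _ _ h1 h2; exact: le_trans h2 h1.
rewrite mem_enum => xS xP.
exists x, y; split => //.
have {}yP p : p \in S -> s y <= s p by move=> pS; apply: yP; rewrite mem_enum.
have {}xP p : p \in S -> s p <= s x by move=> pS; apply: xP; rewrite mem_enum.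
pose f p : 'I_`|s x - s y|.+1 := inord `|s p - s y|.
have f_inj : {in S &, injective f}.
  move=> p q pS qS /(congr1 val); have := yP p pS; have := yP q qS.
  have := xP p pS; have := xP q qS => h1 h2 h3 h4.
  rewrite /= !inordK; [|lia|lia] => h; apply: s_inj => //; lia.
have := max_card (f @: S)%SET; rewrite card_in_imset// card_ord.
by have := yP x xS; lia.
Qed.

Lemma leq_card_interval n (i j o : nat) : (j + o <= n)%N ->
  (j - i <= #|[set c : 'I_n | (i + o <= c < j + o)%N]|)%N.
Proof.
move=> jn; case: n jn => [|n] jn; first by lia.
pose f (t : 'I_(j - i)) : 'I_n.+1 := inord (i + o + t)%N.
have f_inj : injective f.
  move=> t t' /(congr1 val); have := ltn_ord t; have := ltn_ord t' => h1 h2.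
  by rewrite /= !inordK; [|lia|lia] => h; apply: val_inj => /=; lia.
rewrite -[X in (X <= _)%N]card_ord -(card_imset _ f_inj).
apply/subset_leq_card/fintype.subsetP => _ /imsetP[t _ ->]; rewrite inE /f.
by have := ltn_ord t => h; rewrite inordK; lia.
Qed.

Lemma primitive_norm (v1 v2 c1 c2 : int) : c1 * v1 + c2 * v2 = 1 ->
  1 <= v1 * v1 + v2 * v2.
Proof.
move=> bz; have : v1 != 0 \/ v2 != 0.
  have [v10|] := eqVneq v1 0; last by left.
  by right; apply/eqP => v20; move: bz; rewrite v10 v20 !mulr0.
by case=> ?; nia.
Qed.

Section Lattice.
Variables (R : realType) (n : nat).
Implicit Types a b c x y z p : grid n.

Definition gX (p : grid n) : R := (p.1)%:R.
Definition gY (p : grid n) : R := (p.2)%:R.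

Lemma gXY_inj p q : gX p = gX q -> gY p = gY q -> p = q.
Proof.
case: p q => [p1 p2] [q1 q2]; rewrite /gX /gY/= => /eqP; rewrite eqr_nat => /eqP h1.
by move=> /eqP; rewrite eqr_nat => /eqP h2; congr pair; apply: val_inj.
Qed.

Notation cr := (orient gX gY).
Notation dt := (dotat gX gY).
Notation lin := (linat gX gY).

Definition dx a b : int := (b.1 : nat)%:Z - (a.1 : nat)%:Z.
Definition dy a b : int := (b.2 : nat)%:Z - (a.2 : nat)%:Z.

Lemma gXB a b : gX b - gX a = (dx a b)%:~R.
Proof. by rewrite /dx intrB. Qed.

Lemma gYB a b : gY b - gY a = (dy a b)%:~R.
Proof. by rewrite /dy intrB. Qed.

Lemma orientE a b p : cr a b p = (dx a b * dy a p - dy a b * dx a p)%:~R.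
Proof. by rewrite /orient !gXB !gYB [RHS]intrB !intrM. Qed.

(** The lattice length: the number of primitive segments of the edge. *)
Definition llen a b : nat := gcdn `|dx a b| `|dy a b|.

(** The Bezout coefficients will provide an integer coordinate that grows by 1 along each primitive
    step. *)
Lemma llen_primitive a b : a != b -> exists v1 v2 c1 c2 : int,
  [/\ (0 < llen a b)%N, dx a b = (llen a b)%:Z * v1, dy a b = (llen a b)%:Z * v2 &
      c1 * v1 + c2 * v2 = 1].
Proof.
move=> ab.
have k0 : (0 < llen a b)%N.
  rewrite gcdn_gt0 !absz_gt0 -negb_and; apply: contra ab.
  rewrite /dx /dy => /andP[h1 h2]; apply/eqP.
  case: a b h1 h2 => [a1 a2] [b1 b2] /= h1 h2.
  by congr pair; apply: val_inj => /=; lia.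
have [u [v uv]] := Bezoutz (dx a b) (dy a b).
have /dvdzP[v1 e1] : ((llen a b)%:Z %| dx a b)%Z by exact: dvdz_gcdl.
have /dvdzP[v2 e2] : ((llen a b)%:Z %| dy a b)%Z by exact: dvdz_gcdr.
exists v1, v2, u, v; split=> //; rewrite 1?mulrC//.
have k1 : (llen a b)%:Z != 0 by lia.
apply: (mulIf k1); rewrite mul1r; transitivity (u * dx a b + v * dy a b); last by rewrite uv.
by rewrite [in RHS]e1 [in RHS]e2; ring.
Qed.

Variable A : {set grid n}.
Hypothesis noncollinear : forall l1 l2 l0 : R,
  (forall p, p \in A -> l1 * gX p + l2 * gY p = l0) -> l1 = 0 /\ l2 = 0.

Notation hedge := (hedge gX gY A).
Notation vert := (vert gX gY A).

(* The essential points outside [A]: [A] together with [x] is still the set of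
   lattice points of its convex hull. *)
Definition addable x := [/\ x \notin A,
  exists l1 l2, forall p, p \in A -> 0 < lin l1 l2 x p &
  forall a b y (w1 w2 w3 : R), a \in A -> b \in A ->
    0 <= w1 -> 0 <= w2 -> 0 <= w3 -> 0 < w1 + w2 + w3 ->
    w1 * gX a + w2 * gX b + w3 * gX x = (w1 + w2 + w3) * gX y ->
    w1 * gY a + w2 * gY b + w3 * gY x = (w1 + w2 + w3) * gY y -> y \in A \/ y = x].

(* If [x] were at lattice distance [D >= 2] from the edge, the triangle formed
   by [x] and a primitive segment of the edge would contain a lattice point at
   distance 1. *)
Lemma addable_level a b x : hedge a b -> addable x -> cr a b x < 0 ->
  cr a b x = - (llen a b)%:R.
Proof.
move=> hab [xA _ cl] crx; have [aA bA ab _] := hab.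
have [v1 [v2 [c1 [c2 [k0 ex ey bz]]]]] := llen_primitive ab.
set k : int := (llen a b)%:Z in ex ey.
have {}k0 : 0 < k by rewrite /k; lia.
(* The lattice distance of [x] from the line of the edge, positive outside. *)
pose D := v2 * dx a x - v1 * dy a x.
have eD : cr a b x = - (k * D)%:~R.
  by rewrite orientE ex ey -intrN /D; congr (_%:~R); ring.
have D0 : 0 < D.
  by move: crx; rewrite eD oppr_lt0 ltr0z pmulr_rgt0.
have [D1|D2] : D = 1 \/ 2 <= D by lia.
  by rewrite eD D1 mulr1.
exfalso.
(* [(s, D)] are the coordinates of [x - a] in the unimodular basis [(v1, v2)], [(c2, - c1)]. *)
pose s := c1 * dx a x + c2 * dy a x.
have sx : dx a x = s * v1 + D * c2.
  by rewrite /s /D -[LHS]mulr1 -bz; ring.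
have sy : dy a x = s * v2 - D * c1.
  by rewrite /s /D -[LHS]mulr1 -bz; ring.
(* [m] is [s / D] rounded up. The point [a + m (v1, v2) + (c2, - c1)] is at distance 1 and has
   weights [w1], [r], [k], of sum [k D], with respect to [a], [b], [x]. *)
pose r := ((- s) %% D)%Z; pose m := - ((- s) %/ D)%Z.
have sr : s + r = D * m.
  have := divz_eq (- s) D; rewrite -/r /m => h; lia.
have r0 : 0 <= r by rewrite modz_ge0//; lia.
have rD : r < D by rewrite ltz_pmod.
pose y1 := (a.1 : nat)%:Z + m * v1 + c2.
pose y2 := (a.2 : nat)%:Z + m * v2 - c1.
pose w1 := k * D - k - r.
have w10 : 0 <= w1.
  have -> : w1 = (k - 1) * (D - 1) + (D - 1 - r) by rewrite /w1; ring.
  by rewrite addr_ge0 ?mulr_ge0//; lia.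
have Ey1 : w1 * (a.1 : nat)%:Z + r * (b.1 : nat)%:Z + k * (x.1 : nat)%:Z = k * D * y1.
  have -> : (b.1 : nat)%:Z = (a.1 : nat)%:Z + k * v1 by rewrite -ex /dx; ring.
  have -> : (x.1 : nat)%:Z = (a.1 : nat)%:Z + (s * v1 + D * c2) by rewrite -sx /dx; ring.
  rewrite /w1 /y1.
  transitivity (k * D * (a.1 : nat)%:Z + k * v1 * (s + r) + k * D * c2); first by ring.
  by rewrite sr; ring.
have Ey2 : w1 * (a.2 : nat)%:Z + r * (b.2 : nat)%:Z + k * (x.2 : nat)%:Z = k * D * y2.
  have -> : (b.2 : nat)%:Z = (a.2 : nat)%:Z + k * v2 by rewrite -ey /dy; ring.
  have -> : (x.2 : nat)%:Z = (a.2 : nat)%:Z + (s * v2 - D * c1) by rewrite -sy /dy; ring.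
  rewrite /w1 /y2.
  transitivity (k * D * (a.2 : nat)%:Z + k * v2 * (s + r) - k * D * c1); first by ring.
  by rewrite sr; ring.
have kD0 : 0 < k * D by rewrite mulr_gt0.
(* The new coordinates are averages of those of [a], [b], [x], so they stay in the grid. *)
have inbox (i j l : 'I_n) t : w1 * (i : nat)%:Z + r * (j : nat)%:Z + k * (l : nat)%:Z = k * D * t ->
    0 <= t /\ t < n%:Z.
  move=> e; split.
    by rewrite -(pmulr_rge0 _ kD0) -e !addr_ge0// mulr_ge0// ltW.
  suff : 0 <= n%:Z - 1 - t by lia.
  rewrite -(pmulr_rge0 _ kD0) mulrBr -e.
  have -> : k * D * (n%:Z - 1) - (w1 * (i : nat)%:Z + r * (j : nat)%:Z + k * (l : nat)%:Z) =
    w1 * (n%:Z - 1 - (i : nat)%:Z) + r * (n%:Z - 1 - (j : nat)%:Z) + k * (n%:Z - 1 - (l : nat)%:Z).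
    by rewrite /w1; ring.
  have := ltn_ord i; have := ltn_ord j; have := ltn_ord l => h1 h2 h3.
  by rewrite !addr_ge0// mulr_ge0//; lia.
have [y10 y1n] := inbox _ _ _ _ Ey1; have [y20 y2n] := inbox _ _ _ _ Ey2.
have l1 : (`|y1| < n)%N by lia.
have l2 : (`|y2| < n)%N by lia.
pose y : grid n := (Ordinal l1, Ordinal l2).
have yx : gX y = y1%:~R by rewrite /gX/= natr_absz ger0_norm.
have yy : gY y = y2%:~R by rewrite /gY/= natr_absz ger0_norm.
have sumw : w1 + r + k = k * D by rewrite /w1; ring.
have EX : w1%:~R * gX a + r%:~R * gX b + k%:~R * gX x = (w1%:~R + r%:~R + k%:~R) * gX y.
  by rewrite yx -!intrD sumw -intrM -Ey1 /gX !pmulrn -!intrM -!intrD.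
have EY : w1%:~R * gY a + r%:~R * gY b + k%:~R * gY x = (w1%:~R + r%:~R + k%:~R) * gY y.
  by rewrite yy -!intrD sumw -intrM -Ey2 /gY !pmulrn -!intrM -!intrD.
(* The distances of [y] and [x] from the edge are 1 and [D >= 2], so [y] is neither in [A] nor equal
   to [x]. *)
have crxy : (k * D)%:~R * cr a b y = k%:~R * cr a b x.
  have -> : (k * D)%:~R = w1%:~R + r%:~R + k%:~R :> R by rewrite -!intrD sumw.
  transitivity ((gX b - gX a) * ((w1%:~R + r%:~R + k%:~R) * gY y - (w1%:~R + r%:~R + k%:~R) * gY a)
   - (gY b - gY a) * ((w1%:~R + r%:~R + k%:~R) * gX y - (w1%:~R + r%:~R + k%:~R) * gX a)).
    by rewrite /orient; ring.
  by rewrite -EX -EY /orient; ring.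
have kR0 : 0 < (k%:~R : R) by rewrite ltr0z.
have kDR0 : 0 < ((k * D)%:~R : R) by rewrite ltr0z.
have [||||yA|yx'] := cl a b y w1%:~R r%:~R k%:~R aA bA _ _ _ _ EX EY.
- by rewrite ler0z.
- by rewrite ler0z.
- by rewrite ltW.
- by rewrite -!intrD sumw.
- have : 0 <= (k * D)%:~R * cr a b y by rewrite mulr_ge0 ?(ltW kDR0)// (hedge_ge0 hab yA).
  by rewrite crxy pmulr_rge0// leNgt crx.
- move/eqP: crxy; rewrite yx' -subr_eq0 -mulrBl mulf_eq0 (lt_eqF crx) orbF.
  rewrite -intrB intr_eq0.
  have -> : k * D - k = k * (D - 1) by ring.
  by rewrite mulf_eq0; lia.
Qed.

End Lattice.

(** * Counting essential points edge by edge *)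

Section EdgeCounts.
Variables (R : realType) (n : nat) (A : {set grid n}).
Implicit Types a b c x y z p : grid n.

Notation gX := (@gX R n).
Notation gY := (@gY R n).
Notation cr := (orient gX gY).
Notation dt := (dotat gX gY).
Notation lin := (linat gX gY).
Notation hedge := (hedge gX gY A).
Notation vert := (vert gX gY A).
Notation addable := (@addable R n A).
Let XY_inj := @gXY_inj R n.

Hypothesis noncollinear : forall l1 l2 l0 : R,
  (forall p, p \in A -> l1 * gX p + l2 * gY p = l0) -> l1 = 0 /\ l2 = 0.

(** The positive part of the cotangent of the angle at [b]; it bounds how far the lattice line next
    to an edge overhangs [b]. *)
Definition cotp a b c : R := Num.max 0 (dt b a c / cr a b c).

Lemma card_le_of_level a b (m : R) (S : {set grid n}) : a != b ->
  (forall x, x \in S -> cr a b x = m) -> (#|S| <= n)%N.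
Proof.
move=> ab h.
have [f f_inj] : exists f : grid n -> 'I_n, {in S &, injective f}.
  have [e|e] := eqVneq (gX b) (gX a).
    exists (fun x => x.2) => x y xS yS e2.
    have e2' : gY x = gY y by rewrite /gY e2.
    have ey : gY b - gY a != 0.
      rewrite subr_eq0; apply: contra ab => /eqP e'; apply/eqP/XY_inj; exact: esym.
    have := h x xS; rewrite -(h y yS) /orient e2' e subrr !mul0r !sub0r => /oppr_inj.
    by move=> /(mulfI ey)/addIr e1; apply: XY_inj.
  exists (fun x => x.1) => x y xS yS e1.
  have e1' : gX x = gX y by rewrite /gX e1.
  have ex : gX b - gX a != 0 by rewrite subr_eq0.
  have := h x xS; rewrite -(h y yS) /orient e1' => /addIr.
  by move=> /(mulfI ex)/addIr e2; apply: XY_inj.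
by have := max_card (f @: S)%SET; rewrite card_in_imset// card_ord.
Qed.

(** The extreme points of [S] are [t] primitive steps apart. Projected on the edge, this
    displacement is at most the edge itself plus one overhang at each end. *)
Lemma card_strip a b c z (S : {set grid n}) : hedge z a -> hedge a b -> hedge b c ->
    (forall x, x \in S -> [/\ cr a b x = - (llen a b)%:R, 0 <= cr b c x & 0 <= cr z a x]) ->
  #|S|%:R <= (llen a b)%:R + 1 + cotp z a b + cotp a b c.
Proof.
move=> hza hab hbc hS.
have cot0 u v w : 0 <= cotp u v w by rewrite /cotp le_max lexx.
have [->|S0] := eqVneq S finset.set0.
  by rewrite cards0 !addr_ge0.
have [_ _ ab _] := hab.
have [v1 [v2 [c1 [c2 [k0 ex ey bz]]]]] := llen_primitive ab.
pose s x : int := c1 * dx a x + c2 * dy a x.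
have k1 : (llen a b)%:Z != 0 by lia.
have sE x : x \in S -> dx a x = s x * v1 + c2 /\ dy a x = s x * v2 - c1.
  move=> /hS[+ _ _]; rewrite orientE ex ey.
  have -> : (llen a b)%:Z * v1 * dy a x - (llen a b)%:Z * v2 * dx a x =
      (llen a b)%:Z * (v1 * dy a x - v2 * dx a x) by ring.
  rewrite intrM => e.
  have k1R : (llen a b)%:~R != 0 :> R by rewrite intr_eq0.
  have /intr_inj {}e : (v1 * dy a x - v2 * dx a x)%:~R = (-1)%:~R :> R.
    by apply: (mulfI k1R); rewrite e mulrN1.
  have {}e : 1 = v2 * dx a x - v1 * dy a x by lia.
  split.
    by rewrite -[LHS]mulr1 -[X in _ + X]mulr1 {2}e -bz /s; ring.
  by rewrite -[LHS]mulr1 -[X in _ - X]mulr1 {2}e -bz /s; ring.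
have s_inj : {in S &, injective s}.
  move=> x y /sE[x1 x2] /sE[y1 y2] e; apply: XY_inj.
    by apply: (addIr (- gX a)); rewrite !gXB x1 y1 e.
  by apply: (addIr (- gY a)); rewrite !gYB x2 y2 e.
have [x [y [xS yS]]] := card_int_spread s_inj S0.
set t : int := s x - s y => cardS.
have tX : gX x - gX y = t%:~R * v1%:~R.
  rewrite -intrM; transitivity ((gX x - gX a) - (gX y - gX a)); first by ring.
  by rewrite !gXB -intrB (sE x xS).1 (sE y yS).1 /t; congr (_%:~R); ring.
have tY : gY x - gY y = t%:~R * v2%:~R.
  rewrite -intrM; transitivity ((gY x - gY a) - (gY y - gY a)); first by ring.
  by rewrite !gYB -intrB (sE x xS).2 (sE y yS).2 /t; congr (_%:~R); ring.
pose k : R := (llen a b)%:R.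
have uX : gX b - gX a = k * v1%:~R by rewrite gXB ex intrM.
have uY : gY b - gY a = k * v2%:~R by rewrite gYB ey intrM.
have kR : 0 < k by rewrite ltr0n.
pose V : R := v1%:~R ^+ 2 + v2%:~R ^+ 2.
have V1 : 1 <= V.
  rewrite /V !expr2 -!intrM -intrD -[1]/(1%:~R) ler_int.
  exact: primitive_norm bz.
have [_ xbc _] := hS x xS; have [_ _ yza] := hS y yS.
have [crx _ _] := hS x xS; have [cry _ _] := hS y yS.
rewrite -/k in crx cry.
have D1 := hedge_turn XY_inj noncollinear hab hbc.
have D2 := hedge_turn XY_inj noncollinear hza hab.
(* The overhang of [x] beyond [b]: it is bounded because [x] is at level [- k] of the edge and not
   to the right of the next one. *)
have b1 : (gX b - gX a) * (gX x - gX b) + (gY b - gY a) * (gY x - gY b) <= k * cotp a b c.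
  apply: (@le_trans _ _ (k * (dt b a c / cr a b c))); last first.
    by rewrite ler_pM2l// /cotp le_max lexx orbT.
  rewrite mulrA ler_pdivlMr//.
  have e : dt a b b * cr b c x = - (((gX b - gX a) * (gX x - gX b) + (gY b - gY a) * (gY x - gY b)) * cr a b c) - cr a b x * dt b a c.
    by rewrite /orient /dotat; ring.
  have : 0 <= dt a b b * cr b c x by rewrite mulr_ge0// ltW ?dotat_self_gt0.
  by rewrite e crx; lra.
have b2 : - ((gX b - gX a) * (gX y - gX a) + (gY b - gY a) * (gY y - gY a)) <= k * cotp z a b.
  apply: (@le_trans _ _ (k * (dt a z b / cr z a b))); last first.
    by rewrite ler_pM2l// /cotp le_max lexx orbT.
  rewrite mulrA ler_pdivlMr//.
  have e : dt a b b * cr z a y = (((gX b - gX a) * (gX y - gX a) + (gY b - gY a) * (gY y - gY a)) * cr z a b) - cr a b y * dt a z b.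
    by rewrite /orient /dotat; ring.
  have : 0 <= dt a b b * cr z a y by rewrite mulr_ge0// ltW ?dotat_self_gt0.
  by rewrite e cry; lra.
have b3 : k * (t%:~R * V) <= k * (k * V + (cotp z a b + cotp a b c)).
  have -> : k * (t%:~R * V) = (gX b - gX a) * (gX x - gX y) + (gY b - gY a) * (gY x - gY y).
    by rewrite tX tY uX uY /V; ring.
  have -> : k * (k * V + (cotp z a b + cotp a b c)) = (gX b - gX a) * (gX b - gX a) + (gY b - gY a) * (gY b - gY a) + k * cotp z a b + k * cotp a b c.
    by rewrite uX uY /V; ring.
  by move: b1 b2; lra.
(* Dividing by [V >= 1] turns [k * V] into [k] and does not increase the cotangent terms. *)
have b4 : t%:~R <= k + (cotp z a b + cotp a b c).
  have V0 : 0 < V by lra.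
  rewrite -(ler_pM2r V0) mulrDl; rewrite ler_pM2l// in b3; apply: (le_trans b3).
  by rewrite lerD2l ler_peMr// addr_ge0.
have : (#|S|%:Z)%:~R <= (t + 1)%:~R :> R by rewrite ler_int.
rewrite intrD => b5; apply: (le_trans b5); rewrite -/k; lra.
Qed.

(** Two lines that are not parallel meet in at most one point, by Cramer's rule. *)
Lemma card_two_levels a b c (S : {set grid n}) (m m' : R) : 0 < cr a b c ->
  (forall x, x \in S -> cr a b x = m /\ cr b c x = m') -> (#|S| <= 1)%N.
Proof.
move=> D0 hS; apply/fintype.card_le1_eqP => x y /hS[x1 x2] /hS[y1 y2].
have eX : cr a b c * (gX x - gX y) = (cr a b x - cr a b y) * (gX c - gX b) - (cr b c x - cr b c y) * (gX b - gX a).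
  by rewrite /orient; ring.
have eY : cr a b c * (gY x - gY y) = (cr a b x - cr a b y) * (gY c - gY b) - (cr b c x - cr b c y) * (gY b - gY a).
  by rewrite /orient; ring.
rewrite x1 y1 x2 y2 !subrr !mul0r subrr in eX eY.
have nz : cr a b c != 0 by rewrite gt_eqF.
move/eqP: eX; rewrite mulf_eq0 (negPf nz) subr_eq0 /= => /eqP eX.
move/eqP: eY; rewrite mulf_eq0 (negPf nz) subr_eq0 /= => /eqP eY.
exact: XY_inj.
Qed.

Definition edges : {set grid n * grid n} := [set e | `[< hedge e.1 e.2 >]].

Lemma edgesP a b : ((a, b) \in edges) <-> hedge a b.
Proof. by rewrite inE; split=> [/asboolP|h]; last exact/asboolP. Qed.

Lemma card_vert_le (V : {set grid n}) : (forall v, v \in V -> vert v) ->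
  (#|V| <= \sum_(e in edges) llen e.1 e.2)%N.
Proof.
move=> VP; apply: (@leq_trans #|edges|).
  have sub : V \subset (@fst _ _ @: edges)%SET.
    apply/fintype.subsetP => v /VP /(vert_next XY_inj noncollinear)[w hw].
    by apply/imsetP; exists (v, w) => //; exact/edgesP.
  by rewrite (leq_trans (subset_leq_card sub))// leq_imset_card.
rewrite -sum1_card leq_sum// => -[a b] /edgesP[_ _ ab _].
by have [_ [_ [_ [_ [k0 _ _ _]]]]] := llen_primitive ab.
Qed.

(** Double counting of incidences between edges and levels [m c]: by [hedge_shadow_inj], only one
    edge crosses a given level upwards. *)
Lemma sum_shadow_le (d1 d2 : R) (m : 'I_n -> R) (P : pred (grid n * grid n)) :
    (forall a b, P (a, b) -> (llen a b <=
       #|[set c | (d1 * gX a + d2 * gY a <= m c < d1 * gX b + d2 * gY b)%R]|)%N) ->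
  (\sum_(e in edges | P e) llen e.1 e.2 <= n)%N.
Proof.
move=> hP.
pose Q (e : grid n * grid n) (c : 'I_n) :=
  d1 * gX e.1 + d2 * gY e.1 <= m c < d1 * gX e.2 + d2 * gY e.2.
apply: (@leq_trans (\sum_(e in edges | P e) \sum_c Q e c)%N).
  apply: leq_sum => -[a b] /andP[_ Pe]; apply: leq_trans (hP _ _ Pe) _.
  by rewrite -sum1_card big_mkcond/= leq_sum// => c _; rewrite inE /Q /=; case: andP.
rewrite exchange_big/= -[X in (_ <= X)%N]card_ord -sum1_card leq_sum// => c _.
rewrite -big_mkcondr/= sum1_card; apply/fintype.card_le1_eqP => -[a b] [a' b'].
rewrite !unfold_in /= => /andP[/andP[/edgesP h _] /andP[h1 h2]].
move=> /andP[/andP[/edgesP h' _] /andP[h1' h2']].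
by rewrite (hedge_shadow_inj XY_inj h h' h1 h2 h1' h2').
Qed.

(** [llen] divides both coordinate differences, so it is at most the size of a nonzero one, and
    every edge moves in one of the four axis directions. *)
Lemma sum_llen_le : (\sum_(e in edges) llen e.1 e.2 <= 4 * n)%N.
Proof.
pose P1 (e : grid n * grid n) := (e.1.1 < e.2.1)%N.
pose P2 (e : grid n * grid n) := (e.2.1 < e.1.1)%N.
pose P3 (e : grid n * grid n) := (e.1.2 < e.2.2)%N.
pose P4 (e : grid n * grid n) := (e.2.2 < e.1.2)%N.
have dvdle (k i j : nat) : (k %| `|(j : int) - i|)%N -> (i < j)%N -> (k <= j - i)%N.
  by move=> kd ij; rewrite dvdn_leq ?subn_gt0// (_ : j - i = `|(j : int) - i|)%N//; lia.
have dl a b : (llen a b %| `|dx a b|)%N by exact: dvdn_gcdl.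
have dr a b : (llen a b %| `|dy a b|)%N by exact: dvdn_gcdr.
have llenC a b : llen a b = llen b a.
  by rewrite /llen /dx /dy; congr gcdn; lia.
have s1 : (\sum_(e in edges | P1 e) llen e.1 e.2 <= n)%N.
  apply: (@sum_shadow_le 1 0 (fun c : 'I_n => c%:R) P1) => a b ab.
  apply: leq_trans (dvdle _ _ _ (dl a b) ab) _.
  apply: leq_trans (@leq_card_interval n _ _ 0 _) _; first by rewrite addn0 ltnW.
  apply/subset_leq_card/fintype.subsetP => c; rewrite !inE !addn0.
  by rewrite !mul1r !mul0r !addr0 ler_nat ltr_nat.
(* For a decreasing coordinate the levels are negated, so the half-open interval loses its lower
   instead of its upper end; hence the offset 1. *)
have s2 : (\sum_(e in edges | P2 e) llen e.1 e.2 <= n)%N.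
  apply: (@sum_shadow_le (-1) 0 (fun c : 'I_n => - c%:R) P2) => a b ab.
  rewrite llenC; apply: leq_trans (dvdle _ _ _ (dl b a) ab) _.
  apply: leq_trans (@leq_card_interval n _ _ 1 _) _; first by rewrite addn1.
  apply/subset_leq_card/fintype.subsetP => c; rewrite !inE !addn1.
  by rewrite !mulN1r !mul0r !addr0 lerN2 ltrN2 ler_nat ltr_nat ltnS andbC.
have s3 : (\sum_(e in edges | P3 e) llen e.1 e.2 <= n)%N.
  apply: (@sum_shadow_le 0 1 (fun c : 'I_n => c%:R) P3) => a b ab.
  apply: leq_trans (dvdle _ _ _ (dr a b) ab) _.
  apply: leq_trans (@leq_card_interval n _ _ 0 _) _; first by rewrite addn0 ltnW.
  apply/subset_leq_card/fintype.subsetP => c; rewrite !inE !addn0.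
  by rewrite !mul1r !mul0r !add0r ler_nat ltr_nat.
have s4 : (\sum_(e in edges | P4 e) llen e.1 e.2 <= n)%N.
  apply: (@sum_shadow_le 0 (-1) (fun c : 'I_n => - c%:R) P4) => a b ab.
  rewrite llenC; apply: leq_trans (dvdle _ _ _ (dr b a) ab) _.
  apply: leq_trans (@leq_card_interval n _ _ 1 _) _; first by rewrite addn1.
  apply/subset_leq_card/fintype.subsetP => c; rewrite !inE !addn1.
  by rewrite !mulN1r !mul0r !add0r lerN2 ltrN2 ler_nat ltr_nat ltnS andbC.
apply: (@leq_trans (\sum_(e in edges) ((if P1 e then llen e.1 e.2 else 0) +
  (if P2 e then llen e.1 e.2 else 0) + (if P3 e then llen e.1 e.2 else 0) +
  (if P4 e then llen e.1 e.2 else 0)))%N); last first.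
  rewrite !big_split/= -!big_mkcondr/= (leq_trans (leq_add (leq_add (leq_add s1 s2) s3) s4))//; lia.
apply: leq_sum => -[a b] /edgesP[_ _ ab _].
have : [|| P1 (a, b), P2 (a, b), P3 (a, b) | P4 (a, b)].
  apply: contraNT ab; rewrite /P1 /P2 /P3 /P4/=.
  case: a b => [a1 a2] [b1 b2] /= h.
  by apply/eqP; congr pair; apply: val_inj => /=; lia.
by case/or4P => ->; lia.
Qed.

(** [B] stands for [n] or for [1 / q_min], according to the side of the minimum being proved; the
    disjunction in [B_cot] serves both. *)
Variables (Z F : {set grid n}) (B : R).
Hypothesis Z_addable : forall x, x \in Z -> addable x.
Hypothesis F_acute : forall v, acute gX gY A v -> v \in F.
Hypothesis B0 : 0 <= B.
Hypothesis B_cot : forall p q r, hedge p q -> hedge q r -> 0 < dt q p r ->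
  n%:R <= B \/ dt q p r / cr p q r <= B.

Lemma card_visible_le a b : hedge a b ->
  #|[set x in Z | cr a b x < 0]|%:R <=
    (llen a b)%:R + 3 + ((a \in F)%:R + (b \in F)%:R) * B :> R.
Proof.
move=> hab.
have [va vb] := hedge_vert XY_inj hab.
have [z hza] := vert_prev XY_inj noncollinear va.
have [c hbc] := vert_next XY_inj noncollinear vb.
have lev x y u : x \in Z -> hedge y u -> cr y u x < 0 -> cr y u x = - (llen y u)%:R.
  by move=> /Z_addable xZ hyu cr0; exact: (addable_level hyu xZ cr0).
(* [S1] and [S2] hold the points also outside the next or the previous edge, at most one each; the
   rest [S] falls under [card_strip]. *)
pose S0 := [set x in Z | cr a b x < 0].
pose S1 := [set x in S0 | cr b c x < 0].
pose S2 := [set x in S0 | cr z a x < 0].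
pose S := [set x in S0 | (0 <= cr b c x) && (0 <= cr z a x)].
have c1 : (#|S1| <= 1)%N.
  apply: (@card_two_levels a b c _ (- (llen a b)%:R) (- (llen b c)%:R)).
    exact: (hedge_turn XY_inj noncollinear hab hbc).
  by move=> x; rewrite !inE => /andP[/andP[xZ h1] h2]; split; exact: lev.
have c2 : (#|S2| <= 1)%N.
  apply: (@card_two_levels z a b _ (- (llen z a)%:R) (- (llen a b)%:R)).
    exact: (hedge_turn XY_inj noncollinear hza hab).
  by move=> x; rewrite !inE => /andP[/andP[xZ h1] h2]; split; exact: lev.
have sub : S0 \subset (finset.setU (finset.setU S1 S2) S).
  apply/fintype.subsetP => x xS0; rewrite !inE; move: xS0; rewrite inE => -> /=.
  by case: (ltP (cr b c x) 0) => //=; case: (ltP (cr z a x) 0).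
have card0 : (#|S0| <= #|S| + 2)%N.
  rewrite (leq_trans (subset_leq_card sub))// (leq_trans (leq_card_setU _ _))//.
  rewrite addnC leq_add2l (leq_trans (leq_card_setU _ _))//.
  by rewrite (leq_trans (leq_add c1 c2)).
have SP x : x \in S -> [/\ cr a b x = - (llen a b)%:R, 0 <= cr b c x & 0 <= cr z a x].
  by rewrite !inE => /andP[/andP[xZ h1] /andP[h2 h3]]; split => //; exact: lev.
suff : #|S|%:R <= (llen a b)%:R + 1 + ((a \in F)%:R + (b \in F)%:R) * B :> R.
  have : #|S0|%:R <= #|S|%:R + 2 :> R by rewrite -[2]/(2%:R) -natrD ler_nat.
  lra.
(* When [n <= B] at an acute vertex, this bound replaces the one by cotangents. *)
have Sn : #|S|%:R <= n%:R :> R.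
  rewrite ler_nat; have [_ _ ab _] := hab.
  by apply: (@card_le_of_level a b (- (llen a b)%:R)) => // x /SP[].
have na : 0 <= (a \in F)%:R * B by rewrite mulr_ge0.
have nb : 0 <= (b \in F)%:R * B by rewrite mulr_ge0.
have k0 : 0 <= (llen a b)%:R :> R by [].
have cotB p q r : hedge p q -> hedge q r -> cotp p q r <= (q \in F)%:R * B \/
    (q \in F /\ n%:R <= B).
  move=> hpq hqr; rewrite /cotp; have [d0|d0] := leP (dt q p r) 0.
    left; rewrite ge_max mulr_ge0//=; apply: (@le_trans _ _ 0); last by rewrite mulr_ge0.
    by rewrite pmulr_lle0// invr_gt0 (hedge_turn XY_inj noncollinear hpq hqr).
  have qF : q \in F by apply/F_acute/(hedge_acute XY_inj noncollinear hpq hqr).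
  have [|h] := B_cot hpq hqr d0; first by right.
  by left; rewrite qF mul1r ge_max B0.
have [ha|[aF nB]] := cotB _ _ _ hza hab; last first.
  by move: nb; rewrite mulrDl aF mul1r; lra.
have [hb|[bF nB]] := cotB _ _ _ hab hbc; last first.
  by move: na; rewrite mulrDl bF mul1r; lra.
have := card_strip hza hab hbc SP; lra.
Qed.

Lemma sum_vertex_indicator (g : grid n * grid n -> grid n) :
    {in edges &, injective g} ->
  \sum_(e in edges) ((g e \in F)%:R : R) <= #|F|%:R.
Proof.
move=> g_inj; rewrite -natr_sum ler_nat -big_mkcondr/= sum1_card.
rewrite -(@card_in_imset _ _ g).
  by apply/subset_leq_card/fintype.subsetP => _ /imsetP[e /andP[_ eF] ->].
by move=> e e' /andP[he _] /andP[he' _]; exact: g_inj.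
Qed.

Lemma card_addable_le : (#|F| <= 4)%N ->
  #|Z|%:R <= 4 * (\sum_(e in edges) llen e.1 e.2)%:R + 8 * B :> R.
Proof.
move=> F4.
have cover : Z \subset (\bigcup_(e in edges) [set x in Z | (cr e.1 e.2 x < 0)%R])%SET.
  apply/fintype.subsetP => x xZ; have [_ [l1 [l2 lP]] _] := Z_addable xZ.
  have [a [b [hab h]]] := ex_visible_edge XY_inj noncollinear lP.
  by apply/finset.bigcupP; exists (a, b); [exact/edgesP | rewrite inE xZ].
have : #|Z|%:R <= \sum_(e in edges) #|[set x in Z | cr e.1 e.2 x < 0]|%:R :> R.
  rewrite -natr_sum ler_nat (leq_trans (subset_leq_card cover))//.
  elim/big_ind2 : _ => [|U m V m' hU hV|e _]; rewrite ?cards0//.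
  by rewrite (leq_trans (leq_card_setU _ _)) ?leq_add.
move=> /le_trans; apply.
(* Since [llen] is at least 1, it absorbs the constant 3. Each point of [F] starts at most one edge
   and ends at most one, which gives [8 * B]. *)
have h e : e \in edges -> #|[set x in Z | cr e.1 e.2 x < 0]|%:R <=
   4 * (llen e.1 e.2)%:R + ((e.1 \in F)%:R * B + (e.2 \in F)%:R * B) :> R.
  case: e => a b /edgesP hab /=; have := card_visible_le hab.
  have [_ _ ab _] := hab; have [_ [_ [_ [_ [k0 _ _ _]]]]] := llen_primitive ab.
  have : 1 <= (llen a b)%:R :> R by rewrite ler1n.
  lra.
rewrite (le_trans (ler_sum _ h))// !big_split/= -mulr_sumr -!mulr_suml natr_sum lerD2l.
have [i1 i2] : {in edges &, injective (@fst (grid n) (grid n))} /\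
               {in edges &, injective (@snd (grid n) (grid n))}.
  split=> -[a b] [a' b'] /edgesP h1 /edgesP h2 /= e; subst.
    by rewrite (hedge_next_inj XY_inj h1 h2).
  by rewrite (hedge_prev_inj XY_inj h1 h2).
have s1 := sum_vertex_indicator i1; have s2 := sum_vertex_indicator i2.
have F4R : #|F|%:R <= 4 :> R by rewrite -[4]/(4%:R) ler_nat.
rewrite -mulrDl ler_wpM2r//; lra.
Qed.

Lemma card_essential_le (V : {set grid n}) :
    (forall v, v \in V -> vert v) -> (#|F| <= 4)%N ->
  #|V|%:R + #|Z|%:R <= 5 * (\sum_(e in edges) llen e.1 e.2)%:R + 8 * B :> R.
Proof.
move=> /card_vert_le V1 /card_addable_le V2.
have : #|V|%:R <= (\sum_(e in edges) llen e.1 e.2)%:R :> R by rewrite ler_nat.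
lra.
Qed.

End EdgeCounts.

(** * Angles, area and the convex hull *)

Section PlaneGeometry.
Local Open Scope classical_set_scope.
Local Open Scope ring_scope.
Variable R : realType.
Implicit Types (x : R) (u v w : plane R) (P : set (plane R)).

(** This is [cot x <= 1 / x] without division: [sin x - x cos x] vanishes at 0 and has derivative
    [x sin x]. *)
Lemma mul_cos_le_sin x : 0 <= x -> x <= pi -> x * cos x <= sin x.
Proof.
move=> x0 xpi.
have d (y : R) : is_derive y (1 : R) (fun z : R => sin z - z * cos z : R) (y * sin y).
  apply: is_derive_eq; rewrite -![_ *: _]/(_ * _); ring.
have := @ger0_derive1_ndecr R (fun z : R => sin z - z * cos z) 0 pi _ _ _ 0 x (lexx 0) x0 xpi.
rewrite sin0 mul0r subr0 subr_ge0; apply.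
- by move=> y _; have [] := d y.
- move=> y; rewrite in_itv/= => /andP[y0 ypi]; rewrite derive1E.
  have [_ ->] := d y.
  by rewrite mulr_ge0 ?(ltW y0)// sin_ge0_pi// !ltW.
- by apply: derivable_within_continuous => y _; have [] := d y.
Qed.

Lemma dot_self_ge0 u : 0 <= dot u u.
Proof. by rewrite /dot -!expr2 addr_ge0 ?sqr_ge0. Qed.

Lemma dot_cross_sqr u v : dot u v ^+ 2 + cross u v ^+ 2 = dot u u * dot v v.
Proof. by case: u v => [u1 u2] [v1 v2]; rewrite /dot /cross/=; ring. Qed.

Lemma norm2M u v : norm2 u * norm2 v = Num.sqrt (dot u u * dot v v).
Proof. by rewrite /norm2 sqrtrM ?dot_self_ge0. Qed.

Lemma cos_itv u v : -1 <= dot u v / (norm2 u * norm2 v) <= 1.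
Proof.
have h : `|dot u v| <= norm2 u * norm2 v.
  by rewrite norm2M -sqrtr_sqr ler_wsqrtr// -dot_cross_sqr lerDl sqr_ge0.
rewrite -ler_norml normrM normfV.
have N0 : 0 <= norm2 u * norm2 v by rewrite mulr_ge0// sqrtr_ge0.
rewrite (ger0_norm N0); move: N0; rewrite le_eqVlt => /orP[/eqP <-|N0].
  by rewrite invr0 mulr0.
by rewrite ler_pdivrMr// mul1r.
Qed.

(** Angle 0 means equality in the Cauchy-Schwarz inequality with a positive dot product, hence a
    vanishing cross product. *)
Lemma angle_gt0 u v w : cross (u - v) (w - v) != 0 \/ dot (u - v) (w - v) <= 0 ->
  0 < angle u v w.
Proof.
move=> h; rewrite /angle; set a := u - v in h *; set b := w - v in h *.
have /andP[c1 c2] := cos_itv a b.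
apply: acos_gt0; rewrite c1/= lt_neqAle c2 andbT; apply/eqP => e.
have N0 : norm2 a * norm2 b != 0.
  by apply/eqP => N0; move/eqP: e; rewrite N0 invr0 mulr0 eq_sym oner_eq0.
have N1 : 0 < norm2 a * norm2 b by rewrite lt_neqAle eq_sym N0 mulr_ge0// sqrtr_ge0.
have {}e : dot a b = norm2 a * norm2 b by rewrite -[LHS](divfK N0) e mul1r.
case: h => [|h]; last by move: N1; rewrite -e; lra.
have := dot_cross_sqr a b; rewrite e norm2M sqr_sqrtr; last first.
  by rewrite mulr_ge0 ?dot_self_ge0.
by move/eqP; rewrite -subr_eq0 addrAC subrr add0r sqrf_eq0 => ->.
Qed.

Lemma cot_le_invr_angle u v w : 0 < dot (u - v) (w - v) -> 0 < cross (w - v) (u - v) ->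
  dot (u - v) (w - v) / cross (w - v) (u - v) <= (angle u v w)^-1.
Proof.
set a := u - v; set b := w - v => d0 c0.
have c0' : cross a b != 0.
  have -> : cross a b = - cross b a by rewrite /cross; ring.
  by rewrite oppr_eq0 gt_eqF.
have t0 : 0 < angle u v w by apply: angle_gt0; left.
have N0 : 0 < norm2 a * norm2 b.
  rewrite norm2M sqrtr_gt0 -dot_cross_sqr ltr_pwDl ?sqr_ge0// exprn_gt0//.
have [/andP[_ tpi] ct] := acos_def (cos_itv a b).
have st : sin (angle u v w) = cross b a / (norm2 a * norm2 b).
  rewrite /angle -/a -/b sin_acos ?cos_itv//.
  rewrite -[RHS]ger0_norm ?divr_ge0 ?ltW// -sqrtr_sqr; congr (Num.sqrt _).
  rewrite !expr_div_n norm2M sqr_sqrtr ?mulr_ge0 ?dot_self_ge0//.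
  have -> : cross b a ^+ 2 = dot a a * dot b b - dot a b ^+ 2.
    by rewrite -dot_cross_sqr /cross; ring.
  rewrite mulrBl divff// -dot_cross_sqr gt_eqF// ltr_pwDl ?sqr_ge0// exprn_gt0//.
have := mul_cos_le_sin (ltW t0) tpi; rewrite ct st mulrA ler_pM2r ?invr_gt0//.
by move=> h; rewrite ler_pdivrMr// mulrC ler_pdivlMr// mulrC.
Qed.

(** The area integrates the lengths of vertical sections. These have at most one point each or, for
    a vertical line, are empty except over one abscissa. *)
Lemma area_line P (l1 l2 l0 : R) : (l1 != 0) || (l2 != 0) ->
  (forall p, P p -> l1 * p.1 + l2 * p.2 = l0) -> area P = 0%E.
Proof.
move=> l12 hP.
have aE : area P = (\int[@lebesgue_measure R]_x lebesgue_measure (xsection P x))%E by [].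
rewrite aE.
have [l20|l20] := eqVneq l2 0.
  have l10 : l1 != 0 by move: l12; rewrite l20 eqxx orbF.
  pose c := l0 / l1.
  pose K := (@lebesgue_measure R) (xsection P c).
  transitivity (\int[@lebesgue_measure R]_x (K * (\1_[set c] x)%:E))%E.
    apply: eq_integral => x _ /=; have [->|xc] := eqVneq x c.
      by rewrite indicE mem_set// mule1.
    rewrite indicE memNset ?mule0; last by apply/eqP.
    rewrite (_ : xsection P x = set0) ?measure0//.
    apply/seteqP; split=> // y /=; rewrite xsectionE/= => /hP/= e.
    by move/eqP: xc; apply; rewrite /c -e l20 mul0r addr0 mulrAC divff// mul1r.
  rewrite ge0_integralZl//.
  (* [K] may be infinite, but its product with the measure 0 of a point is 0. *)
  - rewrite integral_indic// setIT -[RHS](mule0 K); congr (_ * _)%E.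
    exact: lebesgue_measure_set1.
  - by apply/measurable_EFinP; exact: measurable_indic.
  - exact: measure_ge0.
transitivity (\int[@lebesgue_measure R]_x (cst 0 x : \bar R))%E; last exact: integral0.
apply: eq_integral => x _ /=.
have : xsection P x `<=` [set (l0 - l1 * x) / l2].
  move=> y; rewrite xsectionE/= => /hP/= <-.
  by rewrite addrAC subrr add0r mulrAC divff// mul1r.
by move=> /subset_set1[->|->]; [exact: measure0 | exact: lebesgue_measure_set1].
Qed.

Lemma finite_pos_lbound (Q : set R) : finite_set Q -> (forall q, Q q -> 0 < q) ->
  exists2 m, 0 < m & forall q, Q q -> m <= q.
Proof.
move=> /finite_seqP[s ->] /=; elim: s => [|q s IH] h; first by exists 1.
have [m m0 mP] := IH (fun r rs => h r (mem_behead (s := q :: s) rs)).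
exists (Num.min q m); first by rewrite lt_min m0 h//= mem_head.
move=> r /=; rewrite inE => /orP[/eqP->|/mP]; first by rewrite ge_min lexx.
by move=> h'; rewrite ge_min h' orbT.
Qed.

End PlaneGeometry.

(** * The polygon [P(f)] and the lattice edges of [M_1(f)] *)

Section Hull.
Local Open Scope classical_set_scope.
Local Open Scope ring_scope.
Variables (R : realType) (n : nat) (f : {ffun grid n -> bool}).
Implicit Types (p q : plane R) (a b x : grid n).

Definition ones : {set grid n} := finset (fun x => f x).
Let A := ones.

Notation gX := (@gX R n).
Notation gY := (@gY R n).
Notation gp := (@grid_point R n).
Notation P := (Pf R f).
Let XY_inj := @gXY_inj R n.

Lemma in_ones x : (x \in A) = f x.
Proof. by rewrite inE. Qed.

Lemma crossE a b x : cross (gp b - gp a) (gp x - gp a) = orient gX gY a b x.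
Proof. by []. Qed.

Lemma dotE a b x : dot (gp b - gp a) (gp x - gp a) = dotat gX gY a b x.
Proof. by []. Qed.

Lemma Pf_sub x : f x -> P (gp x).
Proof. by move=> fx C [_]; apply; exists x. Qed.

Lemma Pf_min (C : set (plane R)) : (forall x, f x -> C (gp x)) ->
    (forall p q (t : R), 0 < t -> t < 1 -> C p -> C q ->
       C (t * p.1 + (1 - t) * q.1, t * p.2 + (1 - t) * q.2)) ->
  P `<=` C.
Proof.
move=> CA Cc; apply: smallest_sub; last by move=> _ [x /= fx <-]; exact: CA.
apply/convex_setW => p q /set_mem pC /set_mem qC t t0 t1; apply/mem_set.
exact: Cc.
Qed.

Lemma Pf_convex : @convex_set R (plane R) P.
Proof.
move=> p q t /set_mem pP /set_mem qP; apply/mem_set => C [Cc CA].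
by apply/set_mem/Cc; apply/mem_set; [exact: pP | exact: qP].
Qed.

Lemma Pf_halfplane (l1 l2 l0 : R) :
    (forall x, f x -> l0 <= l1 * gX x + l2 * gY x) ->
  forall p, P p -> l0 <= l1 * p.1 + l2 * p.2.
Proof.
move=> h; apply: (@Pf_min [set p | l0 <= l1 * p.1 + l2 * p.2]) => //= p q t t0 t1 hp hq.
have u0 : 0 < 1 - t by lra.
have := ler_wpM2l (ltW t0) hp; have := ler_wpM2l (ltW u0) hq; lra.
Qed.

Lemma vert_vertex v : vert gX gY A v -> vertex P (gp v).
Proof.
move=> [vA [l1 [l2 hl]]]; split; first by apply: Pf_sub; rewrite -in_ones.
pose L p := l1 * (p.1 - gX v) + l2 * (p.2 - gY v).
(* This set is convex and contains [M1 R f], so on [P] the form is positive except at the vertex. *)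
have PC : P `<=` [set p | p = gp v \/ 0 < L p].
  apply: Pf_min => [x fx|p q t t0 t1 hp hq] /=.
    have [->|xv] := eqVneq x v; first by left.
    by right; apply: hl => //; rewrite in_ones.
  have LE : L (t * p.1 + (1 - t) * q.1, t * p.2 + (1 - t) * q.2) =
    t * L p + (1 - t) * L q by rewrite /L/=; ring.
  have Lv : L (gp v) = 0 by rewrite /L /gX /gY/= !subrr; ring.
  have u0 : 0 < 1 - t by lra.
  rewrite LE; case: hp => [->|hp]; case: hq => [->|hq].
  - by left; rewrite /= -!mulrDl addrC subrK !mul1r.
  - by right; rewrite Lv mulr0 add0r mulr_gt0.
  - by right; rewrite Lv mulr0 addr0 mulr_gt0.
  - by right; rewrite addr_gt0 ?mulr_gt0.
move=> p q t pP qP /andP[t0 t1] e.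
have u0 : 0 < 1 - t%:num by lra.
have e0 : t%:num * L p + (1 - t%:num) * L q = 0.
  transitivity (L (gp v)); last by rewrite /L /gX /gY/= !subrr; ring.
  by rewrite -e /L /=; rewrite /unstable.onem -![_ *: _]/(_ * _); ring.
have [hp|hp] := PC p pP; have [hq|hq] := PC q qP => //; exfalso; move: e0.
- have -> : L p = 0 by rewrite hp /L /gX /gY/= !subrr; ring.
  by rewrite mulr0 add0r => /eqP; rewrite gt_eqF// mulr_gt0.
- have -> : L q = 0 by rewrite hq /L /gX /gY/= !subrr; ring.
  by rewrite mulr0 addr0 => /eqP; rewrite gt_eqF// mulr_gt0.
- by move/eqP; rewrite gt_eqF// addr_gt0 ?mulr_gt0.
Qed.

Lemma hedge_edge a b : hedge gX gY A a b -> edge P (gp a, gp b).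
Proof.
move=> h; have [va vb] := hedge_vert XY_inj h; split=> /=.
- exact: vert_vertex.
- exact: vert_vertex.
- have [_ _ ab _] := h; apply: contra ab => /eqP[h1 h2]; apply/eqP/XY_inj => //.
have h' x : f x -> - (gY b - gY a) * gX a + (gX b - gX a) * gY a <=
    - (gY b - gY a) * gX x + (gX b - gX a) * gY x.
  by rewrite -in_ones => /(hedge_ge0 h); rewrite /orient; lra.
move=> p /(Pf_halfplane h'); rewrite /cross /grid_point /= -/(gX a) -/(gX b) -/(gY a) -/(gY b).
by lra.
Qed.

(** Removing an extreme point keeps [P] convex; if the point were not in [M1 R f], this would
    contradict the minimality of the hull. *)
Lemma vertex_M1 v : vertex P v -> M1 R f v.
Proof.
move=> [vP hv]; apply: contrapT => vM.
have : P `<=` P `\` [set v].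
  apply: smallest_sub; last first.
    move=> _ [x /= fx <-]; split; first exact: Pf_sub.
    by move=> e; apply: vM; exists x.
  apply/convex_setW => p q /set_mem[pP pv] /set_mem[qP qv] t t0 t1.
  apply/mem_set; split.
    by apply/set_mem/Pf_convex; exact/mem_set.
  by move=> e; apply: pv; have [] := hv p q t pP qP _ e; rewrite ?t0.
by move=> /(_ v vP)[_]; exact.
Qed.

(** The sum defining [perimeter] would default to 0 on an infinite support. Finiteness also keeps
    the infimum [qmin] away from 0. *)
Lemma finite_edge : finite_set (edge P).
Proof.
apply: (@sub_finite_set _ _ (M1 R f `*` M1 R f)).
  by move=> e [/vertex_M1 h1 /vertex_M1 h2 _ _].
by apply: finite_setX; apply: finite_image; exact: finite_finset.
Qed.

Lemma llen_le_norm2 a b : a != b -> (llen a b)%:R <= norm2 (gp b - gp a).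
Proof.
move=> ab; have [v1 [v2 [c1 [c2 [k0 ex ey bz]]]]] := llen_primitive ab.
rewrite /norm2 -[dot _ _]/(dotat gX gY a b b) /dotat gXB gYB ex ey !intrM.
have -> : ((llen a b)%:R : R) = Num.sqrt ((llen a b)%:R ^+ 2).
  by rewrite sqrtr_sqr ger0_norm.
rewrite ler_wsqrtr//.
set k : R := (llen a b)%:R; rewrite -[(Posz _)%:~R]/k.
have : 1 <= (v1 * v1 + v2 * v2)%:~R :> R.
  rewrite -[1]/(1%:~R) ler_int.
  exact: primitive_norm bz.
rewrite intrD !intrM => h.
have -> : k * v1%:~R * (k * v1%:~R) + k * v2%:~R * (k * v2%:~R) =
  k ^+ 2 * (v1%:~R * v1%:~R + v2%:~R * v2%:~R) by ring.
by rewrite ler_peMr// sqr_ge0.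
Qed.

(** Lattice edges inject into the edges of [P] and are no longer in lattice length than in norm; all
    terms of the perimeter are nonnegative. *)
Lemma sum_llen_le_perimeter :
  (\sum_(e in edges R A) llen e.1 e.2)%:R <= perimeter P.
Proof.
pose ge (e : grid n * grid n) := (gp e.1, gp e.2).
have ge_inj : injective ge.
  move=> [a b] [a' b'] /= [h1 h2 h3 h4].
  by congr pair; apply: XY_inj.
pose r := [seq ge e | e <- enum (edges R A)].
have ru : uniq r by rewrite map_inj_uniq ?enum_uniq.
have rsub : [set` r] `<=` edge P.
  move=> _ /mapP[[a b] + ->]; rewrite mem_enum => /edgesP; exact: hedge_edge.
rewrite /perimeter (fsbigID [set` r])/=; last exact: finite_edge.
rewrite (_ : edge P `&` [set` r] = [set` r]); last by apply/setIidPr.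
rewrite -[X in X <= _]addr0 lerD//; last first.
  by apply: fsumr_ge0 => e _; exact: sqrtr_ge0.
rewrite (fsbigE r)//; last by move=> e /= ->.
rewrite (eq_bigl (fun e => e \in r)); last by move=> e; rewrite mem_setE.
rewrite -big_seq big_map big_enum natr_sum/= ler_sum// => -[a b] /edgesP[_ _ ab _].
exact: llen_le_norm2.
Qed.

Hypothesis area_gt0 : (0 < area P)%E.

Lemma area_noncollinear (l1 l2 l0 : R) :
  (forall x, x \in A -> l1 * gX x + l2 * gY x = l0) -> l1 = 0 /\ l2 = 0.
Proof.
move=> h; case: (boolP ((l1 != 0) || (l2 != 0))) => [l12|].
  exfalso; suff aP : area P = 0%E by move: area_gt0; rewrite aP ltxx.
  apply: (@area_line _ _ l1 l2 l0 l12) => p pP; apply/eqP; rewrite eq_le.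
  rewrite (@Pf_halfplane l1 l2 l0) ?andbT//; last first.
    by move=> x; rewrite -in_ones => /h ->.
  have := @Pf_halfplane (- l1) (- l2) (- l0) _ p pP; rewrite !mulNr -opprD lerN2; apply.
  by move=> x; rewrite -in_ones => /h <-; lra.
rewrite negb_or => /andP[/negPn/eqP h1 /negPn/eqP h2]; exact: conj h1 h2.
Qed.

(** A zero angle would make consecutive edges opposite, so that [P] lies on both sides of one line,
    against its positive area. *)
Lemma edge_angle_gt0 u v w : edge P (u, v) -> edge P (v, w) -> 0 < angle u v w.
Proof.
move=> [_ _ /= uv huv] [_ _ /= vw hvw].
apply: angle_gt0; case: (eqVneq (cross (u - v) (w - v)) 0) => [c0|]; last by left.
right; rewrite leNgt; apply/negP => d0.
have [] := @area_noncollinear (- (u.2 - v.2)) (u.1 - v.1)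
   (- (u.2 - v.2) * v.1 + (u.1 - v.1) * v.2).
  move=> x; rewrite in_ones => /Pf_sub xP.
  have h1 := huv _ xP; have h2 := hvw _ xP.
  have E : dot (u - v) (u - v) * cross (w - v) (gp x - v) =
      dot (u - v) (w - v) * cross (u - v) (gp x - v).
    have : cross (u - v) (w - v) * dot (u - v) (gp x - v) = 0 by rewrite c0 mul0r.
    rewrite /dot /cross => E; apply/eqP; rewrite -subr_eq0 -oppr_eq0 -E; apply/eqP; ring.
  have h3 : 0 <= cross (u - v) (gp x - v).
    by rewrite -(pmulr_rge0 _ d0) -E mulr_ge0 ?dot_self_ge0.
  have h4 : cross (v - u) (gp x - u) = - cross (u - v) (gp x - v).
    rewrite /cross -![(_ - _).1]/(_.1 - _.1) -![(_ - _).2]/(_.2 - _.2); ring.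
  rewrite h4 in h1.
  move: h1 h3; rewrite /cross -![(_ - _).1]/(_.1 - _.1) -![(_ - _).2]/(_.2 - _.2).
  rewrite -[(gp x).1]/(gX x) -[(gp x).2]/(gY x); lra.
move=> e2 e1; move/eqP: uv; apply; case: u v e1 e2 {huv hvw vw c0 d0} => [u1 u2] [v1 v2] /= e1 e2.
by congr pair; lra.
Qed.

Lemma qmin_ge0 : 0 <= qmin P.
Proof.
rewrite /qmin; set Q := [set q | _].
(* The infimum of the empty set is 0. *)
have [->|/set0P ne] := eqVneq Q set0; first by rewrite inf0.
by apply: lb_le_inf => // _ [u [v [w [h1 h2 ->]]]]; apply/ltW/edge_angle_gt0.
Qed.

Lemma qmin_gt0 a b c : hedge gX gY A a b -> hedge gX gY A b c -> 0 < qmin P.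
Proof.
move=> hab hbc; rewrite /qmin; set Q := [set q | _].
have [||m m0 mP] := @finite_pos_lbound R Q.
- apply: (@sub_finite_set _ _ ((fun e : (plane R * plane R) * (plane R * plane R) =>
      angle e.1.1 e.1.2 e.2.2) @` (edge P `*` edge P))).
    by move=> q [u [v [w [h1 h2 ->]]]]; exists ((u, v), (v, w)).
  by apply: finite_image; apply: finite_setX; exact: finite_edge.
- by move=> _ [u [v [w [h1 h2 ->]]]]; exact: edge_angle_gt0.
apply: (lt_le_trans m0); apply: lb_le_inf => //.
by exists (angle (gp a) (gp b) (gp c)), (gp a), (gp b), (gp c); split => //; exact: hedge_edge.
Qed.

Lemma qmin_le a b c : hedge gX gY A a b -> hedge gX gY A b c ->
  qmin P <= angle (gp a) (gp b) (gp c).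
Proof.
move=> hab hbc; apply: ge_inf.
  by exists 0 => _ [u [v [w [h1 h2 ->]]]]; apply/ltW/edge_angle_gt0.
by exists (gp a), (gp b), (gp c); split => //; exact: hedge_edge.
Qed.

Lemma cot_le_invr_qmin a b c : hedge gX gY A a b -> hedge gX gY A b c ->
  0 < dotat gX gY b a c -> dotat gX gY b a c / orient gX gY a b c <= (qmin P)^-1.
Proof.
move=> hab hbc d0.
have c0 := hedge_turn XY_inj area_noncollinear hab hbc.
have q0 := qmin_gt0 hab hbc.
have e : orient gX gY a b c = cross (gp c - gp b) (gp a - gp b).
  by rewrite crossE; exact: orient_rot.
rewrite e -dotE in c0 d0 *; apply: le_trans (cot_le_invr_angle d0 c0) _.
have qa := qmin_le hab hbc.
by rewrite lef_pV2 ?posrE// (lt_le_trans q0).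
Qed.

(** Some inequality of [g] fails at [x] but holds at all other points of [M1 R f], where [g] agrees
    with [f]; it supplies the strictly supporting form. *)
Lemma essential_vert x : f x -> essential (threshold_class R n) f x -> vert gX gY A x.
Proof.
move=> fx [g [k [a0 [a1 [a2 hg]]]] gf]; split; first by rewrite in_ones.
have gx : ~ g x by move=> gx; have := (gf x).2 erefl; rewrite fx gx.
have [i hi] : exists i, a0 i < a1 i * (x.1)%:R + a2 i * (x.2)%:R.
  apply: contrapT => h; apply: gx; apply/hg => i; rewrite leNgt; apply/negP => hi.
  by apply: h; exists i.
exists (- a1 i), (- a2 i) => p; rewrite in_ones => fp px.
have /hg/(_ i) : g p.
  have [e|/eqP e] := eqVneq (g p) (f p); first by rewrite e.
  by move/eqP/gf: e px => ->; rewrite eqxx.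
by rewrite /linat /gX /gY; lra.
Qed.

(** An inequality of [f] violated at [x] separates [x] from [A]. The half planes of [g] contain [A]
    and [x], hence all their convex combinations. *)
Lemma essential_addable x : threshold_class R n f -> ~~ f x ->
  essential (threshold_class R n) f x -> addable R A x.
Proof.
move=> [k' [b0 [b1 [b2 hf]]]] fx [g [k [a0 [a1 [a2 hg]]]] gf].
split; first by rewrite in_ones.
  have [i hi] : exists i, b0 i < b1 i * (x.1)%:R + b2 i * (x.2)%:R.
    apply: contrapT => h; move/negP: fx; apply; apply/hf => i.
    by rewrite leNgt; apply/negP => hi; apply: h; exists i.
  exists (- b1 i), (- b2 i) => p; rewrite in_ones => /hf/(_ i).
  by rewrite /linat /gX /gY; lra.
move=> a b y w1 w2 w3; rewrite !in_ones => fa fb w10 w20 w30 w0 eX eY.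
have gfE (p : grid n) : p != x -> g p = f p.
  move=> px; have [//|/eqP e] := eqVneq (g p) (f p).
  by move/eqP/gf: e px => ->; rewrite eqxx.
have gx : g x by have := (gf x).2 erefl; rewrite (negPf fx); case: (g x).
have gA (p : grid n) : f p -> g p.
  by move=> fp; rewrite gfE//; apply: contraNneq fx => <-.
have [->|yx] := eqVneq y x; [by right | left].
rewrite -gfE//; apply/hg => i.
have /hg/(_ i) ha := gA a fa; have /hg/(_ i) hb := gA b fb; have /hg/(_ i) hx := gx.
rewrite -(ler_pM2l w0) mulrDr mulrCA (mulrCA _ (a2 i)) -/(gX y) -/(gY y) -eX -eY.
have := ler_wpM2l w10 ha; have := ler_wpM2l w20 hb; have := ler_wpM2l w30 hx.
rewrite /gX /gY; lra.
Qed.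

End Hull.

(** * Combining the two sides of the minimum *)

Theorem theorem2 (R : realType) :
  exists C : R, 0 < C /\
    forall (n : nat) (f : {ffun grid n -> bool}),
      (2 <= n)%N -> threshold_class R n f -> (0 < area (Pf R f))%E ->
      #|essential_points f (threshold_class R n)|%:R <=
        C * Num.min n%:R (perimeter (Pf R f) + (qmin (Pf R f))^-1).
Proof.
(* From [5 * k + 8 * B]: with [k <= 4 * n] and [B = n] this is [28 * n]. For the other side [k] is
   at most the perimeter and [B] is [1 / q_min], so 8 would do. *)
exists 28; split=> // n f _ tf area0.
have nc := area_noncollinear area0.
pose S := essential_points f (threshold_class R n).
pose V := [set x in S | f x]%SET; pose Z := [set x in S | ~~ f x]%SET.
have cardS : #|S|%:R = #|V|%:R + #|Z|%:R :> R.
  rewrite -natrD -(cardsID (ones f) S); congr (_ + _)%:R.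
    by congr #|pred_of_set _|; apply/setP => x; rewrite !inE.
  by congr #|pred_of_set _|; apply/setP => x; rewrite !inE andbC.
have [F [F4 F_acute]] := acute_four nc.
have Z_addable x : x \in Z -> addable R (ones f) x.
  by rewrite !inE => /andP[/asboolP ex fx]; exact: essential_addable.
have VP x : x \in V -> vert (@gX R n) (@gY R n) (ones f) x.
  by rewrite !inE => /andP[/asboolP ex fx]; exact: essential_vert.
have bound B : 0 <= B -> _ := fun B0 B_cot => @card_essential_le R n _ nc Z F B Z_addable F_acute B0 B_cot V VP F4.
rewrite -/S cardS; set k := (\sum_(e in edges R (ones f)) llen e.1 e.2)%N in bound.
rewrite minr_pMr// le_min; apply/andP; split.
  have := bound n%:R (ler0n _ _) (fun p q r _ _ _ => or_introl (lexx _)).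
  have : k%:R <= 4 * n%:R :> R by rewrite -[4]/(4%:R) -natrM ler_nat sum_llen_le.
  lra.
have q0 : 0 <= (qmin (Pf R f))^-1 by rewrite invr_ge0 qmin_ge0.
have := bound _ q0 (fun p q r h1 h2 h3 => or_intror (cot_le_invr_qmin area0 h1 h2 h3)).
have := sum_llen_le_perimeter R f; rewrite -/k => kp.
have : 0 <= k%:R :> R by [].
lra.
Qed.
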